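(* Let $G\subseteq\Omega$ be a subdomain, let $1\le p\le\infty$, and assume $u\in W^{r+\delta,p}(G)$ $(\delta>0)$ and that there exists a multi-index $\gamma$ with $|\gamma|=r$ such that $\|D^{\gamma}u\|_{0,p,G}>0$ and $D^{\gamma}v_h=0$ for any $v_h\in V_h$. Then the following lower bound of the approximation error holds when the family $\{\mathcal{T}_h\}$ of partitions is quasi-uniform: $$\inf_{v_h\in V_h}\|u-v_h\|_{j,p,G,h}\ \ge\ C_1h^{r-j},\qquad 0\le j\le r,$$ where $C_1$ is a positive constant independent of the mesh size $h$ but dependent on $u$.
   Context: $\Omega\subset\mathbb{R}^n$ ($n\ge1$) is a bounded polytopic domain with Lipschitz continuous boundary. $W^{s,p}(G)$ denotes the usual Sobolev space with norm $\|\cdot\|_{s,p,G}$ and seminorm $|\cdot|_{s,p,G}$; $D^\alpha$ is the partial derivative of multi-index $\alpha$ and $|\alpha|=\sum_i\alpha_i$. $\mathcal{T}_h$ is a face-to-face partition of $\Omega$ into elements $K$ (triangles, rectangles, tetrahedra, bricks, etc.), so $\bar\Omega=\bigcup_{K\in\mathcal{T}_h}K$; $h_K=\mathrm{diam}\,K$ and $h=\max_{K\in\mathcal{T}_h}h_K$. For $G\subseteq\Omega$, $\mathcal{T}_h^G=\{K\in\mathcal{T}_h: K\subset G\}$. A family $\{\mathcal{T}_h\}$ is regular if there is $\sigma>0$ with $h_K/\tau_K<\sigma$ for all $K\in\mathcal{T}_h$, where $\tau_K$ is the maximum diameter of an inscribed ball in $K$. A regular family is quasi-uniform if there is $\beta>0$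 with $\max\{h/h_K: K\in\mathcal{T}_h\}\le\beta$. $V_h$ is the finite element space of piecewise polynomial functions of degree less than $r$ ($r\ge1$ an integer) built on $\mathcal{T}_h$; derivatives of $v_h\in V_h$ are taken element by element. The piecewise seminorms are $|v|_{j,p,G,h}=\big(\sum_{K\in\mathcal{T}_h^G}\int_K\sum_{|\alpha|=j}|D^\alpha v|^p\,dK\big)^{1/p}$ for $1\le p<\infty$ and $|v|_{j,\infty,G,h}=\max_{K\in\mathcal{T}_h^G}|v|_{j,\infty,K}$; $\|v\|_{j,p,G,h}$ is the corresponding piecewise full norm, containing the seminorms of all orders $0,\dots,j$.
   Formalization: The bound is stated for all partitions with h below some h_0 > 0 independent of the mesh: on a coarse mesh no element need lie in G (e.g. Ω=(0,1), G=(0.1,0.2), one element), so the left side is 0 and the claim for all h fails. *)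

(* Defs.v *)
From HB Require Import structures.
From mathcomp Require Import all_boot all_order all_algebra finmap.
From mathcomp Require Import all_classical all_reals all_analysis.

Set Implicit Arguments.
Unset Strict Implicit.
Unset Printing Implicit Defensive.
Import Order.TTheory GRing.Theory Num.Theory.
Import numFieldNormedType.Exports.

Local Open Scope classical_set_scope.
Local Open Scope ring_scope.

Definition rV_display : measure_display.
Proof. exact: default_measure_display. Qed.

Section rV_measurable.
Context {R : realType} (n : nat).

Let coor (i : 'I_n) (x : 'rV[R]_n) : measurableTypeR R := x 0 i.

Let rV_measurable0 : g_sigma_preimage coor set0.
Proof. exact: sigma_algebra0. Qed.

Let rV_measurableC A : g_sigma_preimage coor A -> g_sigma_preimage coor (~` A).
Proof. exact: sigma_algebraC. Qed.

Let rV_measurable_bigcup (F : (set 'rV[R]_n)^nat) :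
  (forall i, g_sigma_preimage coor (F i)) ->
  g_sigma_preimage coor (\bigcup_i F i).
Proof. exact: sigma_algebra_bigcup. Qed.

HB.instance Definition _ := @isMeasurable.Build rV_display 'rV[R]_n
  (g_sigma_preimage coor) rV_measurable0 rV_measurableC rV_measurable_bigcup.

Lemma measurable_rV_coor (i : 'I_n) : measurable_fun setT (coor i).
Proof.
move=> _ Y mY; rewrite setTI; apply: sub_sigma_algebra => /=.
rewrite -bigcup_seq/=; exists i => /=; first by rewrite mem_index_enum.
by exists Y => //; rewrite setTI.
Qed.

Lemma measurable_fun_rV d (T : measurableType d) (f : T -> 'rV[R]_n) :
  (forall i, measurable_fun setT (coor i \o f)) -> measurable_fun setT f.
Proof.
move=> mf.
apply: (@measurability _ _ _ _ _ _
  (\big[setU/set0]_(i < n) preimage_set_system setT (coor i) measurable)).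
  by [].
rewrite -bigcup_seq => _ [_ [i _ [A mA <-]] <-].
rewrite !setTI -comp_preimage -[X in measurable X]setTI.
exact: mf.
Qed.

End rV_measurable.

Section lebesgue_rV.
Context {R : realType}.

Definition rV_cons n (p : measurableTypeR R * 'rV[R]_n) : 'rV[R]_n.+1 :=
  \row_i (if unlift 0 i is Some j then p.2 0 j else p.1).

Lemma measurable_rV_cons n : measurable_fun setT (@rV_cons n).
Proof.
apply: measurable_fun_rV => i; case: (unliftP 0 i) => [j|] ->.
  rewrite (_ : _ \o _ =
    (fun v : 'rV[R]_n => v 0 j : measurableTypeR R) \o snd); last first.
    by apply/funext => p /=; rewrite mxE liftK.
  by apply: measurableT_comp; [exact: measurable_rV_coor|exact: measurable_snd].
rewrite (_ : _ \o _ = fst) //.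
by apply/funext => p /=; rewrite mxE unlift_none.
Qed.

Let rV_uncons n (x : 'rV[R]_n.+1) : measurableTypeR R * 'rV[R]_n :=
  (x 0 0, \row_j x 0 (lift 0 j)).

Let measurable_rV_uncons n : measurable_fun setT (@rV_uncons n).
Proof.
apply/measurable_fun_pair; first exact: measurable_rV_coor.
apply: measurable_fun_rV => i.
rewrite (_ : _ \o _ = fun x : 'rV[R]_n.+1 => x 0 (lift 0 i) : measurableTypeR R).
  exact: measurable_rV_coor.
by apply/funext => x /=; rewrite mxE.
Qed.

Let rV_consK n : cancel (@rV_cons n) (@rV_uncons n).
Proof.
move=> [a v]; rewrite /rV_uncons mxE unlift_none; congr pair.
by apply/rowP => j; rewrite !mxE liftK.
Qed.

Section step.
Variables (n : nat) (mu : {sigma_finite_measure set 'rV[R]_n -> \bar R}).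

Definition lebesgue_rVS : set 'rV[R]_n.+1 -> \bar R :=
  pushforward (lebesgue_measure \x mu)%E (@rV_cons n).

Let lebesgue_rVS_set0 : lebesgue_rVS set0 = 0%E.
Proof. by rewrite /lebesgue_rVS /pushforward preimage_set0 measure0. Qed.

Let lebesgue_rVS_ge0 A : (0 <= lebesgue_rVS A)%E.
Proof. exact: (measure_ge0 (lebesgue_measure \x mu)%E). Qed.

Let lebesgue_rVS_sigma_additive : semi_sigma_additive lebesgue_rVS.
Proof.
move=> F mF tF mUF; rewrite /lebesgue_rVS /pushforward preimage_bigcup.
have mc A : measurable A -> measurable (@rV_cons n @^-1` A).
  by move=> mA; rewrite -[X in measurable X]setTI; exact: measurable_rV_cons.
apply: measure_semi_sigma_additive => //.
- by move=> k; exact: mc.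
- apply/trivIsetP => /= i j _ _ ij; rewrite -preimage_setI.
  by move/trivIsetP : tF => /(_ _ _ _ _ ij) ->//; rewrite preimage_set0.
- by rewrite -preimage_bigcup; exact: mc.
Qed.

HB.instance Definition _ := isMeasure.Build _ _ _ lebesgue_rVS
  lebesgue_rVS_set0 lebesgue_rVS_ge0 lebesgue_rVS_sigma_additive.

Let lebesgue_rVS_sigma_finite : sigma_finite setT lebesgue_rVS.
Proof.
have /sigma_finiteP[F [TF ndF Foo]] := sigma_finiteT (@lebesgue_measure R).
have /sigma_finiteP[H [TH ndH Hoo]] := sigma_finiteT mu.
exists (fun k => @rV_uncons n @^-1` (F k `*` H k)).
  rewrite predeqE => x; split => // _.
  have [k _ Fk] : (\bigcup_k F k) (x 0 0) by rewrite -TF.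
  have [l _ Hl] : (\bigcup_k H k) (rV_uncons x).2 by rewrite -TH.
  exists (maxn k l) => //; split.
    by move: Fk; exact/subsetPset/ndF/leq_maxl.
  by move: Hl; exact/subsetPset/ndH/leq_maxr.
move=> k; have [mF Fk] := Foo k; have [mH Hk] := Hoo k; split.
  rewrite -[X in measurable X]setTI; apply: measurable_rV_uncons => //.
  exact: measurableX.
rewrite /lebesgue_rVS /pushforward -comp_preimage.
rewrite (_ : _ \o _ = id) ?preimage_id; last first.
  by apply/funext => p; exact: rV_consK.
by rewrite product_measure1E// lte_mul_pinfty// ge0_fin_numE.
Qed.

HB.instance Definition _ := @Measure_isSigmaFinite.Build _ _ _ lebesgue_rVS
  lebesgue_rVS_sigma_finite.

End step.

Fixpoint lebesgue_rV (n : nat) : {sigma_finite_measure set 'rV[R]_n -> \bar R} :=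
  match n with
  | 0 => \d_(0 : 'rV[R]_0)
  | n'.+1 => lebesgue_rVS (lebesgue_rV n')
  end.

End lebesgue_rV.

Lemma measurable_box (R : realType) n (A : 'I_n -> set (measurableTypeR R)) :
  (forall i, measurable (A i)) ->
  measurable [set x : 'rV[R]_n | forall i, A i (x 0 i)].
Proof.
move=> mA.
rewrite (_ : [set x | _] = \bigcap_(i in [set: 'I_n])
    ((fun x : 'rV[R]_n => x 0 i : measurableTypeR R) @^-1` A i)).
  apply: fin_bigcap_measurable => //; move=> i _.
  by rewrite -[X in measurable X]setTI; apply: measurable_rV_coor.
by apply/seteqP; split => x /= h i; [move=> _; exact: h|exact: (h i I)].
Qed.

Lemma lebesgue_rV_box (R : realType) n (A : 'I_n -> set (measurableTypeR R)) :
  (forall i, measurable (A i)) ->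
  lebesgue_rV n [set x : 'rV[R]_n | forall i, A i (x 0 i)] =
  (\prod_(i < n) lebesgue_measure (A i))%E.
Proof.
elim: n A => [|n IH] A mA.
  rewrite big_ord0 /= /dirac indicE mem_set//= => -[]//.
rewrite big_ord_recl -IH//= /lebesgue_rVS /pushforward.
rewrite -product_measure1E //; last first.
  by apply: (@measurable_box _ _ (fun i => A (lift ord0 i))) => i; exact: mA.
congr (_ _); apply/seteqP; split => -[a v] /=.
  by move=> h; split=> [|i]; [have := h 0|have := h (lift 0 i)];
    rewrite mxE ?unlift_none ?liftK.
move=> [h1 h2] i; rewrite mxE; case: unliftP => [j|] -> //; exact: h2.
Qed.

Section geometry.
Context {R : realType} {n : nat}.
Implicit Types (x y : 'rV[R]_n) (A K Omega : set 'rV[R]_n).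

(* `|x| is the sup norm of 'rV[R]_n, which induces the same topology. *)
Definition enorm x : R := Num.sqrt (\sum_i x 0 i ^+ 2).

Definition dotp x y : R := \sum_i x 0 i * y 0 i.

Definition diam K : R := sup [set enorm (x - y) | x in K & y in K].

Definition indiam K : R :=
  sup [set d | 0 <= d /\ exists c, [set x | enorm (x - c) <= d / 2] `<=` K].

Definition polytope K := exists s : seq 'rV[R]_n,
  K = [set x | exists w : 'I_(size s) -> R,
         [/\ forall i, 0 <= w i, \sum_i w i = 1 & x = \sum_i w i *: s`_i]].

(* The improper faces K (a = 0, b = 0) and set0 (a = 0, b = 1) are included. *)
Definition is_face F K := exists (a : 'rV[R]_n) (b : R),
  (forall x, K x -> dotp a x <= b) /\ F = K `&` [set x | dotp a x = b].

Definition is_domain A := [/\ open A, connected A & A !=set0].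

Definition polytopic Omega := exists P : {fset (set 'rV[R]_n)},
  (forall K, K \in P -> polytope K) /\ closure Omega = \bigcup_(K in [set` P]) K.

(* Around a boundary point, Omega lies strictly above the graph of a Lipschitz
   function over the hyperplane orthogonal to the unit vector e.  A function of
   the n - 1 coordinates orthogonal to e is encoded as a function psi on R^n
   that is invariant under translations along e. *)
Definition lipschitz_boundary Omega := forall x, (closure Omega `\` Omega) x ->
  exists (e : 'rV[R]_n) (rho : R) (psi : 'rV[R]_n -> R),
    [/\ enorm e = 1, 0 < rho,
        [lipschitz psi y | y in setT],
        forall y t, psi (y + t *: e) = psi y &
        forall y, enorm (y - x) < rho -> (Omega y <-> psi y < dotp y e)].

End geometry.

Section meshes.
Context {R : realType} {n : nat}.
Implicit Types (T : {fset (set 'rV[R]_n)}) (Omega : set 'rV[R]_n).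

Definition is_mesh Omega T :=
  [/\ forall K, K \in T -> polytope K /\ K° !=set0,
      closure Omega = \bigcup_(K in [set` T]) K,
      forall K L, K \in T -> L \in T -> K != L -> K° `&` L° = set0 &
      forall K L, K \in T -> L \in T -> is_face (K `&` L) K].

Definition mesh_size T : R := \big[Num.max/0]_(K <- T) diam K.

Definition regular_family (I : Type) (T : I -> {fset (set 'rV[R]_n)}) :=
  exists2 sigma : R, 0 < sigma &
    forall i K, K \in T i -> diam K / indiam K < sigma.

Definition quasi_uniform_family (I : Type) (T : I -> {fset (set 'rV[R]_n)}) :=
  regular_family T /\
  exists2 beta : R, 0 < beta &
    forall i K, K \in T i -> mesh_size (T i) / diam K <= beta.

End meshes.

Section derivatives.
Context {R : realType} {n : nat}.
Implicit Types (a : 'I_n -> nat) (f g w phi : 'rV[R]_n -> R).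
Implicit Types (U : set 'rV[R]_n) (p : \bar R).
Local Notation leb := (lebesgue_rV n).

Definition mindex_deg a : nat := (\sum_i a i)%N.

Definition partial (i : 'I_n) f : 'rV[R]_n -> R := fun x => 'D_(delta_mx 0 i) f x.

Definition mpartial a f : 'rV[R]_n -> R :=
  foldr (fun i g => iter (a i) (partial i) g) f (enum 'I_n).

Definition smooth f :=
  forall (s : seq 'I_n) x, differentiable (foldr partial f s) x.

Definition test_function U phi :=
  [/\ smooth phi, compact (closure [set x | phi x != 0]) &
      closure [set x | phi x != 0] `<=` U].

Definition loc_integrable U f := measurable_fun U f /\
  forall A, compact A -> A `<=` U -> leb.-integrable A (EFin \o f).

Definition is_weak_deriv U a w g :=
  [/\ loc_integrable U w, loc_integrable U g &
      forall phi, test_function U phi ->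
        \int[leb]_(x in U) (w x * mpartial a phi x)%:E =
        ((-1) ^+ mindex_deg a)%:E * \int[leb]_(x in U) (g x * phi x)%:E]%E.

(* A representative of the a.e.-unique weak derivative D^a w on U; it is the
   zero function when w has no such derivative. *)
Definition wderiv U a w : 'rV[R]_n -> R := get (is_weak_deriv U a w).

Definition Lp_norm U p f : \bar R := ('N[leb]_p[EFin \o (f \_ U)])%E.

Definition in_Lp U p f := measurable_fun U f /\ (Lp_norm U p f < +oo)%E.

Definition sobolev_int U (m : nat) p w :=
  forall a, (mindex_deg a <= m)%N ->
    exists2 g, is_weak_deriv U a w g & in_Lp U p g.

(* The L^p(U x U) norm of |g x - g y| / |x - y|^(n/p + theta), with n/p = 0
   for p = +oo: the Sobolev-Slobodeckij seminorm, resp. the Hoelder seminorm. *)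
Definition slobodeckij U (theta : R) p g : \bar R :=
  let e : R := theta + (if p is q%:E then n%:R / q else 0) in
  ('N[(leb \x leb)]_p[EFin \o
     ((fun z : 'rV[R]_n * 'rV[R]_n =>
         (g z.1 - g z.2) / enorm (z.1 - z.2) `^ e)%R \_ (U `*` U))])%E.

Definition sobolev U (s : R) p w :=
  let m := Num.truncn s in
  sobolev_int U m p w /\
  (s != m%:R -> forall a, mindex_deg a = m ->
     (slobodeckij U (s - m%:R) p (wderiv U a w) < +oo)%E).

End derivatives.

Section finite_elements.
Context {R : realType} {n : nat}.
Implicit Types (T : {fset (set 'rV[R]_n)}) (G K : set 'rV[R]_n).
Implicit Types (v w : 'rV[R]_n -> R) (p : \bar R).
Local Notation leb := (lebesgue_rV n).

(* Degree less than r in each variable.  This contains the polynomials of total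
   degree less than r and, for rectangles and bricks, the tensor-product ones. *)
Definition poly_lt (r : nat) (q : 'rV[R]_n -> R) :=
  exists c : {ffun 'I_n -> 'I_r} -> R,
    forall x, q x = \sum_a c a * \prod_i x 0 i ^+ a i.

(* Values on the null set of element boundaries are left free. *)
Definition piecewise_poly (r : nat) T v :=
  forall K, K \in T -> exists2 q, poly_lt r q & forall x, K° x -> v x = q x.

Definition fe_space (r : nat) T (V : set ('rV[R]_n -> R)) :=
  [/\ V (cst 0), forall (c : R) v w, V v -> V w -> V (c *: v + w) &
      V `<=` piecewise_poly r T].

(* The type {ffun 'I_n -> 'I_j.+1} contains all multi-indices of order j. *)
Definition mindex j (a : {ffun 'I_n -> 'I_j.+1}) : 'I_n -> nat := fun i => a i.

(* Integration is over the interiors of the elements, whose boundaries are null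
   sets on which the weak derivatives are unspecified. *)
Definition pw_seminorm (j : nat) p G T w : \bar R :=
  (if p is q%:E then
     (\sum_(K <- T | `[< K `<=` G >])
       \int[leb]_(x in K°)
         (\sum_(a : {ffun 'I_n -> 'I_j.+1} | mindex_deg (mindex a) == j)
            `|wderiv K° (mindex a) w x| `^ q)%R%:E) `^ q^-1
   else
     \big[maxe/0]_(K <- T | `[< K `<=` G >])
       \big[maxe/0]_(a : {ffun 'I_n -> 'I_j.+1} | mindex_deg (mindex a) == j)
         Lp_norm K° +oo (wderiv K° (mindex a) w))%E.

Definition pw_norm (j : nat) p G T w : \bar R :=
  (if p is q%:E then
     (\sum_(i < j.+1) pw_seminorm i p G T w `^ q) `^ q^-1
   else \big[maxe/0]_(i < j.+1) pw_seminorm i p G T w)%E.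

End finite_elements.

(* Main.v *)
Require Import Defs.
From mathcomp Require Import all_boot all_order all_algebra finmap.
From mathcomp Require Import ring lra.
From mathcomp Require Import all_classical all_reals all_analysis.
From mathcomp Require Import measurable_realfun ess_sup_inf.

(* Let g = D^gamma u.  Since D^gamma v = 0 on each element K, integration by
   parts against a bump function phi supported in K gives
     int_K g phi = +- int_K D^alpha (u - v) D^(gamma - alpha) phi
   for every alpha <= gamma with |alpha| = j.  If phi has scale h, the right-hand
   side is at most C h^(j - r) times the L^1 norm of D^alpha (u - v) on K.
   As g is not almost everywhere 0, there are a box Q in G and a constant a != 0
   such that g is close to a in L^1(Q), relatively to |a| |Q|.  The elements
   meeting a slightly smaller box lie in Q when h is small, there are at least
   c |Q| / h^n of them, and by shape regularity each one contains a cube of side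
   comparable to h, so the left-hand sides add up to at least c |a| |Q|.  Hence
   the L^1 norm, and then the L^p norm, of D^alpha (u - v) is at least C h^(r - j). *)

(** The bound is proved by contradiction: suppose some v has norm below C1 h^(r - j). Three
    quantities are compared with X = |a| m (kappa/4)^n W, where W is the volume of the box: the
    bumps collect at least X, the deviation of g from a costs at most X/2 by the choice of [eps],
    and the derivative of u - v costs at most X/4 by the choice of [C1]. The box and a are found
    before any mesh is considered, so the mesh family enters [C1] only through sigma and beta, and
    [h0] depends on the box alone. Some threshold is unavoidable: on a coarse mesh no element may
    lie in G, and the piecewise norm is then 0. Since g is only locally integrable, the box cannot
    come from continuity. It comes from a substitute for Lebesgue differentiation: a function whose
    integral is nonnegative on all boxes has nonnegative integral on all Borel sets. The bumps live
    on cubes, not on the elements, so that they are products of one-variable functions with explicit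
    iterated derivatives. *)

Set Implicit Arguments.
Unset Strict Implicit.
Unset Printing Implicit Defensive.
Import Order.TTheory GRing.Theory Num.Theory.
Import numFieldNormedType.Exports.

Local Open Scope classical_set_scope.
Local Open Scope ring_scope.

(** * Topology and measurability of row vectors *)

Section rV_topology.
Context {R : realType} {n : nat}.
Implicit Types (x y : 'rV[R]_n) (U A : set 'rV[R]_n).

Lemma rV_norm_leP x (e : R) : 0 <= e ->
  reflect (forall i, `|x 0 i| <= e) (`|x| <= e).
Proof.
move=> e0; rewrite /Num.norm/= mx_normrE.
apply: (iffP (bigmax_leP _ _ _ _)) => [[_ h] i|h]; first exact: (h (0, i)).
by split=> // -[i j] _; rewrite /= ord1; exact: h.
Qed.

Lemma rV_coord_le x i : `|x 0 i| <= `|x|.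
Proof. by move: i; apply/rV_norm_leP. Qed.

Lemma rV_norm_ltP x (e : R) : 0 < e ->
  reflect (forall i, `|x 0 i| < e) (`|x| < e).
Proof.
move=> e0; rewrite /Num.norm/= mx_normrE.
apply: (iffP (bigmax_ltP _ _ _ _)) => [[_ h] i|h]; first exact: (h (0, i)).
by split=> // -[i j] _; rewrite /= ord1; exact: h.
Qed.

Lemma measurable_box_ball x (e : R) :
  measurable [set y : 'rV[R]_n | forall i, `|x 0 i - y 0 i| < e].
Proof.
pose A i := [set t : measurableTypeR R | `|x 0 i - t| < e].
apply: (@measurable_box _ _ A) => i.
rewrite (_ : A i = ball (x 0 i) e); last by [].
by apply: open_measurable; exact: ball_open.
Qed.

(** The sigma-algebra is generated by the coordinates, not by the open sets. An open set is the
    countable union of the open sup-norm balls inside it with rational centre and radius 1/(k+1). *)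
Lemma open_measurable_rV U : open U -> measurable U.
Proof.
move=> oU.
pose F (z : 'rV[rat]_n * nat) := 
  let B := [set y : 'rV[R]_n | forall i, `|ratr (z.1 0 i) - y 0 i| < z.2.+1%:R^-1] in
  if `[< B `<=` U >] then B else set0.
rewrite (_ : U = \bigcup_z F z).
  apply: countable_bigcupT_measurable => [|z]; first exact: countableP.
  rewrite /F; case: ifP => // _.
  have := measurable_box_ball (\row_i ratr (z.1 0 i)) z.2.+1%:R^-1.
  by congr measurable; apply/seteqP; split=> y h i; have := h i; rewrite !mxE.
apply/seteqP; split=> [x Ux|x [z _]]; last first.
  by rewrite /F; case: ifPn => // /asboolP h; exact: h.
have /nbhs_ballP[e /= e0 eU] : nbhs x U by move/open_nbhs_nbhs : (conj oU Ux).
have [k ke] : exists k : nat, k.+1%:R^-1 < e / 2.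
  have e2 : 0 < e / 2 by rewrite divr_gt0.
  near \oo => k; exists k.
  by near: k; exact: near_infty_natSinv_lt (PosNum e2).
have h i : {q : rat | `|ratr q - x 0 i| < k.+1%:R^-1 :> R}.
  have lt2 : x 0 i - k.+1%:R^-1 < x 0 i + k.+1%:R^-1.
    by rewrite ltrD2l gt0_cp// invr_gt0.
  have /cid[q] := rat_in_itvoo lt2.
  by rewrite in_itv/= => qx; exists q; rewrite ltr_distl.
exists (\row_i sval (h i), k) => //; rewrite /F ifT /=.
  by move=> i; rewrite mxE; exact: svalP (h i).
apply/asboolP => y hy; apply: eU; rewrite -ball_normE /=.
apply/rV_norm_ltP => // i; rewrite !mxE.
have := hy i; rewrite mxE => {}hy.
rewrite (splitr e) (le_lt_trans (ler_distD (ratr (sval (h i))) _ _))//.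
apply: ltrD; last exact: lt_trans hy ke.
by rewrite distrC; exact: lt_trans (svalP (h i)) ke.
Unshelve. all: by end_near. Qed.

Lemma closed_measurable_rV A : closed A -> measurable A.
Proof.
move=> cA; rewrite -[A]setCK; apply: measurableC.
by apply: open_measurable_rV; exact: closed_openC.
Qed.

Lemma compact_measurable_rV A : compact A -> measurable A.
Proof.
by move=> cA; apply: closed_measurable_rV; apply: compact_closed => //;
  exact: norm_hausdorff.
Qed.

Lemma continuous_measurable_rV (f : 'rV[R]_n -> R) :
  continuous f -> measurable_fun setT f.
Proof.
move=> cf; apply: (measurability _ (RGenOpens.measurableE R)).
move=> _ [_ [a [b ->] <-]]; rewrite setTI.
by apply: open_measurable_rV; move/continuousP : cf; apply; exact: interval_open.
Qed.

(** The parameter [e] is half the side. *)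
Definition cube (c : 'rV[R]_n) (e : R) : set 'rV[R]_n :=
  [set x | forall i, `|x 0 i - c 0 i| <= e].

Let side (c : 'rV[R]_n) (e : R) i : set (measurableTypeR R) :=
  `[c 0 i - e, c 0 i + e]%classic.

Let cubeE c e : cube c e = [set x | forall i, side c e i (x 0 i)].
Proof.
by apply/seteqP; split=> x h i; have := h i; rewrite /side/= in_itv/= ler_distl.
Qed.

Lemma measurable_cube (c : 'rV[R]_n) (e : R) : measurable (cube c e).
Proof.
by rewrite cubeE; apply: measurable_box => i; exact: measurable_itv.
Qed.

Lemma lebesgue_rV_cube (c : 'rV[R]_n) (e : R) : 0 <= e ->
  lebesgue_rV n (cube c e) = ((2 * e) ^+ n)%:E.
Proof.
move=> e0; rewrite cubeE.
have -> := @lebesgue_rV_box R n (side c e); last by move=> i; exact: measurable_itv.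
rewrite (eq_bigr (fun=> (2 * e)%:E)); last first.
  move=> i _; rewrite /side lebesgue_measure_itv/= lte_fin.
  have E : c 0 i + e - (c 0 i - e) = 2 * e by ring.
  rewrite -EFinB E; case: ltP => //; rewrite -subr_le0 E => h.
  by congr EFin; apply/eqP; rewrite eq_le h mulr_ge0.
by rewrite prodEFin prodr_const card_ord.
Qed.

End rV_topology.

(** * Integration by parts *)

Section integration_by_parts.
Context {R : realType}.

(** Both derivatives depend only on difference quotients along a line. This transfers a partial
    derivative in R^(n+1) to a slice of dimension n or 1, which lives in another normed space. *)
Lemma eq_growth_rate (V V' W : normedModType R) (f : V -> W) (g : V' -> W)
    a v b w : (forall h : R, f (h *: v + a) = g (h *: w + b)) ->
  ('D_v f a = 'D_w g b) * (derivable f a v = derivable g b w).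
Proof.
move=> fg; have fgab : f a = g b by have := fg 0; rewrite !scale0r !add0r.
have E : (fun h => h^-1 *: ((f \o shift a) (h *: v) - f a)) =
         (fun h => h^-1 *: ((g \o shift b) (h *: w) - g b)).
  by apply/funext => h; rewrite /= fg fgab.
by split; rewrite /derive /derivable E.
Qed.

Lemma bounded_support_integrable n (f : 'rV[R]_n -> R) (M B : R) :
  measurable_fun setT f -> (forall x, `|f x| <= B) ->
  (forall x, M < `|x| -> f x = 0) ->
  (lebesgue_rV n).-integrable setT (EFin \o f).
Proof.
move=> mf fB f0.
pose A : set 'rV[R]_n := cube 0 `|M|; have mA : measurable A by exact: measurable_cube.
have -> : EFin \o f = (EFin \o f) \_ A.
  apply/funext => x; rewrite patchE; case: ifPn => // /negP xA /=.
  rewrite f0// ltNge; apply/negP => xM; apply: xA; rewrite inE => i.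
  by rewrite mxE subr0 (le_trans (rV_coord_le _ _))// (le_trans xM)// ler_norm.
apply/(integrable_mkcond _ mA); apply: measurable_bounded_integrable => //.
- by rewrite -[X in (X < _)%E]/(lebesgue_rV n (cube 0 `|M|)) lebesgue_rV_cube// ltry.
- exact: measurable_funTS.
- exists B; split; first exact: num_real.
  by move=> e Be x _ /=; exact: le_trans (fB x) (ltW Be).
Qed.

Lemma partial_near_eq n (i : 'I_n) (f g : 'rV[R]_n -> R) x :
  {near x, f =1 g} -> partial i f x = partial i g x.
Proof. exact: near_eq_derive. Qed.

Lemma partial_eq0_far n (i : 'I_n) (f : 'rV[R]_n -> R) M :
  (forall x, M < `|x| -> f x = 0) -> forall x, M < `|x| -> partial i f x = 0.
Proof.
move=> f0 x Mx; rewrite (@partial_near_eq _ _ _ (cst 0)).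
  by rewrite /partial derive_cst.
near=> y; rewrite f0//; near: y.
apply: (cvgr_gt (`|x|)) => //.
exact: (@norm_continuous R 'rV[R]_n).
Unshelve. all: by end_near. Qed.

Lemma continuous_far_bounded n (f : 'rV[R]_n -> R) M :
  continuous f -> (forall x, M < `|x| -> f x = 0) ->
  exists B, forall x, `|f x| <= B.
Proof.
move=> cf f0; pose A := [set x : 'rV[R]_n | `|x| <= M].
have cA : compact A.
  apply: bounded_closed_compact.
    by exists M; split; [exact: num_real|move=> e Me x /= xM; exact: le_trans (ltW Me)].
  rewrite (_ : A = (fun x => `|x|) @^-1` [set t | t <= M]) //.
  by apply: closed_comp; [move=> x _; exact: norm_continuous|exact: closed_le].
have [B [_ hB]] : bounded_set (f @` A).
  apply: compact_bounded; apply: continuous_compact => //.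
  exact: continuous_subspaceT.
exists (Num.max 0 (B + 1)) => x; have [xM|Mx] := leP `|x| M.
  rewrite le_max; apply/orP; right.
  by apply: hB; [rewrite ltrDl|exists x].
by rewrite f0// normr0 le_max lexx.
Qed.

Lemma rV_cons_norm n (t : R) (y : 'rV[R]_n) :
  `|rV_cons (t : measurableTypeR R, y)| = Num.max `|t| `|y|.
Proof.
apply/eqP; rewrite eq_le; apply/andP; split.
  apply/rV_norm_leP => [|i]; first by rewrite le_max normr_ge0.
  rewrite mxE; case: unliftP => [j|] _ /=; rewrite le_max ?lexx//.
  by rewrite rV_coord_le orbT.
rewrite ge_max; apply/andP; split.
  have := rV_coord_le (rV_cons (t : measurableTypeR R, y)) 0.
  by rewrite mxE unlift_none.
apply/rV_norm_leP => // i.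
have := rV_coord_le (rV_cons (t : measurableTypeR R, y)) (lift 0 i).
by rewrite mxE liftK.
Qed.

Definition row_cons n (t : R) (y : 'rV[R]_n) : 'rV[R]_n.+1 :=
  rV_cons (t : measurableTypeR R, y).

Lemma rV_consDl n (t h : R) (y : 'rV[R]_n) :
  h *: delta_mx 0 0 + row_cons t y = row_cons (h + t) y.
Proof.
apply/rowP => i; rewrite !mxE; case: unliftP => [j|] -> /=.
  by rewrite mulr0 add0r.
by rewrite mulr1.
Qed.

Lemma rV_consDr n (t h : R) (y : 'rV[R]_n) j :
  h *: delta_mx 0 (lift 0 j) + row_cons t y = row_cons t (h *: delta_mx 0 j + y).
Proof.
apply/rowP => i; rewrite !mxE; case: unliftP => [k|] -> /=.
  by rewrite (inj_eq lift_inj) !mxE.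
by rewrite mulr0 add0r.
Qed.

Lemma rV_cons_continuous_l n (y : 'rV[R]_n) : continuous (fun t => row_cons t y).
Proof.
move=> t; apply/cvgrPdist_lt => /= e e0; near=> s.
apply/rV_norm_ltP => // i; rewrite !mxE; case: unliftP => [j|] _ /=.
  by rewrite subrr normr0.
near: s; exact: cvgr_dist_lt.
Unshelve. all: by end_near. Qed.

Lemma rV_cons_continuous_r n t : continuous (@row_cons n t).
Proof.
move=> y; apply/(@cvgrPdist_lt R 'rV[R]_n.+1 'rV[R]_n (nbhs y)) => /= e e0; near=> s.
apply/rV_norm_ltP => // i; rewrite !mxE; case: unliftP => [j|] _ /=.
  have : `|y - s| < e by near: s; exact: cvgr_dist_lt.
  by move/(rV_norm_ltP _ e0)/(_ j); rewrite !mxE.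
by rewrite subrr normr0.
Unshelve. all: by end_near. Qed.

Lemma rV_cons_integrable n (f : 'rV[R]_n.+1 -> \bar R) :
  (lebesgue_rV n.+1).-integrable setT f ->
  (lebesgue_measure \x lebesgue_rV n)%E.-integrable setT (f \o @rV_cons R n).
Proof.
move/integrableP => [mf lty]; apply/integrableP; split.
  by apply: measurableT_comp => //; exact: measurable_rV_cons.
move: lty; rewrite /= /lebesgue_rVS.
rewrite ge0_integral_pushforward//; first exact: measurable_rV_cons.
by apply: measurableT_comp.
Qed.

Lemma integral_cons n (f : 'rV[R]_n.+1 -> \bar R) :
  (lebesgue_rV n.+1).-integrable setT f ->
  (\int[lebesgue_rV n.+1]_x f x =
   \int[lebesgue_measure \x lebesgue_rV n]_p f (rV_cons p))%E.
Proof.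
move=> intf; rewrite /= /lebesgue_rVS integral_pushforward//.
- exact: measurable_rV_cons.
- by case/integrableP : intf.
- exact: rV_cons_integrable.
Qed.

Lemma integral_derive1_eq0 (F F' : R -> R) (M : R) :
  (forall t, is_derive t (1 : R) F (F' t)) -> continuous F' ->
  (forall t, M < `|t| -> F t = 0) ->
  (\int[lebesgue_measure]_t (F' t)%:E = 0)%E.
Proof.
(* Strictly beyond the support, so that [F] vanishes at both ends of [-b, b] and [F'] outside it. *)
move=> dF cF' F0; pose b : R := `|M| + 1.
have b0 : 0 < b by rewrite ltr_pwDr.
have Mb : M < b by rewrite (le_lt_trans (ler_norm _))// ltrDl.
have F'0 t : b < `|t| -> F' t = 0.
  move=> bt; rewrite -(@derive_val _ _ _ _ _ _ _ (dF t)).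
  rewrite (@near_eq_derive _ _ _ _ (cst 0)) ?derive_cst//.
  near=> s; rewrite F0// (lt_trans Mb)//; near: s.
  apply: (cvgr_gt (`|t|)) => //; exact: norm_continuous.
have -> : (\int[lebesgue_measure]_t (F' t)%:E =
           \int[lebesgue_measure]_(t in `[(- b)%R, b]) (F' t)%:E)%E.
  rewrite [RHS]integral_mkcond; apply: eq_integral => t _.
  rewrite patchE; case: ifPn => // /negP tb; rewrite F'0// ltNge.
  by apply/negP => bt; apply: tb; rewrite inE/= in_itv/= -ler_norml.
rewrite (@continuous_FTC2 _ F' F).
- by rewrite !F0 ?normrN ?gtr0_norm// subee.
- by rewrite gtrN.
- exact: continuous_subspaceT.
- split.
  + by move=> t _; exact: ex_derive.
  + apply: cvg_at_right_filter; apply: differentiable_continuous.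
    by apply/derivable1_diffP; exact: ex_derive.
  + apply: cvg_at_left_filter; apply: differentiable_continuous.
    by apply/derivable1_diffP; exact: ex_derive.
- by move=> t _; rewrite derive1E; exact: derive_val.
Unshelve. all: by end_near. Qed.

(** Induction on the dimension through Fubini. If [i] is not the first coordinate, the induction
    hypothesis applies to each slice with the first coordinate fixed; if it is, the inner integral
    is one-dimensional and vanishes by the fundamental theorem of calculus. *)
Lemma integral_partial_eq0 n (i : 'I_n) (f : 'rV[R]_n -> R) (M : R) :
  (forall x, derivable f x (delta_mx 0 i)) -> continuous (partial i f) ->
  (forall x, M < `|x| -> f x = 0) ->
  (\int[lebesgue_rV n]_x (partial i f x)%:E = 0)%E.
Proof.
elim: n i f => [[]//|n IH] i f df cf f0.
have [B fB] := continuous_far_bounded cf (@partial_eq0_far _ i _ _ f0).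
have intf : (lebesgue_rV n.+1).-integrable setT (EFin \o partial i f).
  apply: (bounded_support_integrable (M := M) (B := B)) => //.
    exact: continuous_measurable_rV.
  exact: partial_eq0_far.
rewrite (integral_cons intf).
have {}intf := rV_cons_integrable intf.
case: (unliftP 0 i) => [j|] ij.
  rewrite -integral12_prod_meas1 //; apply: integral0_eq => t _.
  rewrite /fubini_F.
  have E y h : f (h *: delta_mx 0 i + row_cons t y) =
    (f \o row_cons t) (h *: delta_mx 0 j + y) by rewrite /= ij rV_consDr.
  have E' y : partial i f (row_cons t y) = partial j (f \o row_cons t) y.
    exact: (eq_growth_rate (E y)).1.
  rewrite -(IH j (f \o row_cons t)).
  - by apply: eq_integral => y _; rewrite -E'.
  - move=> y; have := df (row_cons t y).
    by rewrite (eq_growth_rate (E y)).2.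
  - rewrite (_ : partial _ _ = partial i f \o row_cons t); last first.
      by apply/funext => y; rewrite -E'.
    move=> y; apply: continuous_comp; first exact: rV_cons_continuous_r.
    exact: cf.
  - by move=> y My; rewrite /= f0// rV_cons_norm lt_max My orbT.
rewrite -integral21_prod_meas1 //; apply: integral0_eq => y _.
rewrite /fubini_G.
have E t h : f (h *: delta_mx 0 i + row_cons t y) =
    (fun t => f (row_cons t y)) (h *: 1 + t).
  by rewrite ij rV_consDl [h *: 1]mulr1.
apply: (@integral_derive1_eq0 (fun t => f (row_cons t y)) _ M).
- move=> t; apply: DeriveDef.
    by have [_ <-] := eq_growth_rate (g := fun t => f (row_cons t y)) (E t).
  by have [<- _] := eq_growth_rate (g := fun t => f (row_cons t y)) (E t).
- move=> t; apply: continuous_comp; first exact: rV_cons_continuous_l.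
  exact: cf.
- by move=> t Mt; rewrite f0// rV_cons_norm lt_max Mt.
Qed.

End integration_by_parts.

(** * A smooth bump function on the line *)

Section bump.
Context {R : realType}.
Implicit Types (f g : R -> R) (F : nat -> R -> R).

(** A smooth function of one variable with all its derivatives as data, so that partial derivatives
    of products are read off from an index. *)
Definition derivative_tower F := forall k t, is_derive t (1 : R) (F k) (F k.+1 t).

(** Finite-order differentiability that does not name the derivatives. It serves to multiply two
    towers: the Leibniz rule closes it under products by induction, and [Cdiff_tower] recovers a
    tower. *)
Fixpoint Cdiff k f : Prop :=
  if k is k'.+1 then
    exists2 f', (forall t, is_derive t (1 : R) f (f' t)) & Cdiff k' f'
  else True.

Lemma CdiffW k f : Cdiff k.+1 f -> Cdiff k f.
Proof.
elim: k f => [//|k IH] f [f' df]; move/IH => cf'; exists f' => //.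
Qed.

Lemma CdiffD k f g : Cdiff k f -> Cdiff k g -> Cdiff k (f \+ g).
Proof.
elim: k f g => [//|k IH] f g [f' df cf'] [g' dg cg'].
by exists (f' \+ g'); [move=> t; exact: is_deriveD|exact: IH].
Qed.

Lemma CdiffM k f g : Cdiff k f -> Cdiff k g -> Cdiff k (f \* g).
Proof.
elim: k f g => [//|k IH] f g cf cg.
have := cf; have := cg; move=> [g' dg cg'] [f' df cf'].
exists ((f \* g') \+ (g \* f')) => [t|].
  exact: (@is_deriveM _ _ f g t 1 (f' t) (g' t)).
by apply: CdiffD; apply: IH => //; exact: CdiffW.
Qed.

Lemma tower_Cdiff F m k : derivative_tower F -> Cdiff m (F k).
Proof. by move=> dF; elim: m k => [//|m IH] k; exists (F k.+1). Qed.

Lemma Cdiff_tower f : (forall m, Cdiff m f) ->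
  derivative_tower (fun k => f^`(k)%classic).
Proof.
move=> cf k; have {cf} : forall m, Cdiff m (f^`(k)%classic).
  elim: k => [//|k IH] m; have [f' df cf'] := IH m.+1.
  rewrite derive1nS (_ : _^`()%classic = f') //.
  by apply/funext => t; rewrite derive1E; exact: derive_val.
move=> /(_ 1%N)[f' df _] t; have := df t.
by rewrite derive1nS derive1E derive_val.
Qed.

Lemma tower_affine F (a b : R) : derivative_tower F ->
  derivative_tower (fun k t => a ^+ k * F k (a * t + b)).
Proof.
move=> dF k t.
have d1 : is_derive t (1 : R) (fun t => a * t + b) a.
  rewrite -[X in is_derive _ _ _ X]addr0; apply: is_deriveD.
  rewrite -[X in is_derive _ _ _ X]mulr1; exact: is_deriveZ.
have := @is_deriveZ _ _ _ _ (a ^+ k) t 1 _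
  (is_derive1_comp (g := fun t => a * t + b) (dF k (a * t + b)) d1).
by rewrite /GRing.scale/= [X in _ * X]mulrC mulrA -exprSr.
Qed.

(* Each monomial is controlled by y^k <= k! exp(y). *)
Lemma poly_expN_bounded (p : {poly R}) :
  exists C, forall y, 0 <= y -> `|p.[y] * expR (- y)| <= C.
Proof.
exists (\sum_(i < size p) `|p`_i| * (i`!)%:R) => y y0.
rewrite horner_coef mulr_suml (le_trans (ler_norm_sum _ _ _))//.
apply: ler_sum => i _; rewrite -mulrA normrM ler_wpM2l//.
rewrite ger0_norm ?mulr_ge0 ?exprn_ge0 ?expR_ge0//.
rewrite expRN ler_pdivrMr ?expR_gt0//.
case: (nat_of_ord i) => [|m].
  by rewrite expr0 mul1r (le_trans _ (expR_ge1Dx _))// lerDl.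
have := expR_ge1Dxn m y0; rewrite -(ler_pM2l (x := (m.+1)`!%:R)) ?ltr0n ?fact_gt0//.
apply: le_trans; rewrite mulrDr mulr1 mulrCA divff ?mulr1 ?lerDr//.
Qed.

(* From (P(1/t) exp(-1/t))' = t^-2 (P - P')(1/t) exp(-1/t). *)
Definition expV_poly : nat -> {poly R} :=
  fix P k := if k is k'.+1 then 'X^2 * (P k' - (P k')^`()) else 1.

(* The k-th derivative of exp(-1/t), extended by 0 to t <= 0. *)
Definition expV k (t : R) : R :=
  if 0 < t then (expV_poly k).[t^-1] * expR (- t^-1) else 0.

(** At 0 the difference quotient [expV k z / z] tends to 0: with P = [expV_poly k], the function y^2
    P(y) exp(-y) is bounded for y >= 0, and y = 1/z gives |[expV k z]| <= C z^2 for z > 0. *)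
Lemma expV_tower : derivative_tower expV.
Proof.
move=> k t; have [t0|t0|->] := ltgtP t 0.
- rewrite /expV ltNge (ltW t0)/=.
  apply: (@near_eq_is_derive _ _ _ (cst 0)).
  by near=> s; rewrite ltNge ltW//; near: s; exact: lt_nbhsl.
- pose h (s : R) : R := (expV_poly k).[s^-1] * expR (- s^-1).
  apply: (@near_eq_is_derive _ R R h).
    by near=> s; rewrite /expV ifT//; near: s; exact: lt_nbhsr.
  have tn0 : t != 0 by rewrite gt_eqF.
  have dV : is_derive t (1 : R) (fun s : R => s^-1) (- t ^- 2).
    have := @is_deriveV _ id t 1 1 tn0 (is_derive_id _ _).
    by rewrite /GRing.scale/= mulr1.
  have dp : is_derive (t^-1) (1 : R) (horner (expV_poly k)) ((expV_poly k)^`()).[t^-1].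
    exact: is_derive_poly.
  have d1 := is_derive1_comp dp dV.
  have dN := is_deriveN dV.
  have d2 := is_derive1_comp (g := fun s : R => - s^-1) (is_derive_expR (- t^-1)) dN.
  rewrite (_ : h = (horner (expV_poly k) \o GRing.inv) *
                   (expR \o (fun s : R => - s^-1)))//.
  apply: (is_derive_eq (is_deriveM d1 d2)); rewrite /expV t0 /= /GRing.scale/= !hornerE/=.
  rewrite opprK exprVn; ring.
- apply/is_derive1_caratheodory.
  have [C hC] := poly_expN_bounded ('X^2 * expV_poly k).
  have C0 : 0 <= C by apply: le_trans (hC 0 _).
  exists (fun z => expV k z / z); split.
  + move=> z; rewrite {2}/expV ltxx !subr0; have [->|z0] := eqVneq z 0.
      by rewrite /expV ltxx !mul0r.
    by rewrite mulfVK.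
  + apply/cvgrPdist_le => /= e e0; near=> z.
    rewrite {1}/expV ltxx mul0r sub0r normrN /expV.
    case: ifPn => [z0|_]; last by rewrite mul0r normr0 ltW.
    have h : `|(expV_poly k).[z^-1] * expR (- z^-1)| <= C * z ^+ 2.
      have := hC z^-1; rewrite invr_ge0 (ltW z0) => /(_ isT).
      rewrite hornerM hornerXn -mulrA normrM ger0_norm ?exprn_ge0 ?invr_ge0 ?(ltW z0)//.
      by rewrite exprVn ler_pdivrMl ?exprn_gt0// [z ^+ 2 * C]mulrC.
    rewrite normrM [X in _ * X]gtr0_norm ?invr_gt0// ler_pdivrMr//.
    rewrite (le_trans h)// expr2 mulrA ler_wpM2r ?(ltW z0)//.
    suff : z <= e / (C + 1).
      rewrite ler_pdivlMr ?ltr_wpDl// => zC; rewrite (le_trans _ zC)// mulrC.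
      by rewrite mulrDr lerDl mulr1 ltW.
    apply: ltW; near: z; apply: lt_nbhsl.
    by rewrite divr_gt0// ltr_wpDl.
  + by rewrite /expV ltxx invr0 mulr0.
Unshelve. all: by end_near. Qed.

Lemma expV0_ge0 t : 0 <= expV 0 t.
Proof. by rewrite /expV; case: ifP => // _; rewrite hornerE mul1r expR_ge0. Qed.

Lemma expV0_le1 t : expV 0 t <= 1.
Proof.
rewrite /expV; case: ifPn => // t0; rewrite hornerE mul1r -expR0 ler_expR.
by rewrite oppr_le0 invr_ge0 ltW.
Qed.

Lemma expV_le0 k t : t <= 0 -> expV k t = 0.
Proof. by rewrite /expV ltNge => ->. Qed.

(** The function is exp(-1/(1 + t)) exp(-1/(1 - t)) on ]-1, 1[. For |t| <= 1/2 both 1 + t and 1 - t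
    are at least 1/2, so m = exp(-2)^2 works. Each derivative is continuous and vanishes outside
    [-1, 1], hence is bounded. *)
Lemma bump_tower : exists F : nat -> R -> R,
  [/\ derivative_tower F,
      forall k t, 1 < `|t| -> F k t = 0,
      forall t, 0 <= F 0%N t <= 1,
      exists2 m, 0 < m & forall t, `|t| <= 2^-1 -> m <= F 0%N t &
      forall k, exists B, forall t, `|F k t| <= B].
Proof.
pose e1 t := expV 0 (1 * t + 1); pose e2 t := expV 0 (- 1 * t + 1).
have c1 m : Cdiff m e1.
  have := tower_Cdiff m 0 (tower_affine 1 1 expV_tower).
  by under eq_fun do rewrite expr0 mul1r.
have c2 m : Cdiff m e2.
  have := tower_Cdiff m 0 (tower_affine (-1) 1 expV_tower).
  by under eq_fun do rewrite expr0 mul1r.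
have tF := Cdiff_tower (fun m => CdiffM (c1 m) (c2 m)).
set F := (fun k => _) in tF.
have F0 k t : 1 < `|t| -> F k t = 0.
  elim: k t => [|k IH] t t1.
    rewrite /F derive1n0 /= /e1 /e2; move: t1; rewrite ltr_normr => /orP[t1|t1].
      by rewrite [X in _ * X]expV_le0 ?mulr0//; lra.
    by rewrite [X in X * _]expV_le0 ?mul0r//; lra.
  have := tF k t => h; rewrite -(@derive_val _ _ _ _ _ _ _ h).
  rewrite (@near_eq_derive _ _ _ _ (cst 0)) ?derive_cst//.
  near=> s; rewrite IH//; near: s.
  apply: (cvgr_gt (`|t|)) => //; exact: norm_continuous.
have cF k : continuous (F k).
  move=> t; apply: differentiable_continuous; apply/derivable1_diffP.
  by have := tF k t => h; exact: ex_derive.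
exists F; split => //.
- move=> t; rewrite /F derive1n0 /= mulr_ge0 ?expV0_ge0//=.
  by rewrite mulr_ile1 ?expV0_ge0 ?expV0_le1.
- exists (expR (-2) * expR (-2)); first by rewrite mulr_gt0 ?expR_gt0.
  move=> t t2; rewrite /F derive1n0 /=.
  have h s : 2^-1 <= s -> expR (-2) <= expV 0 s.
    move=> s2; have s0 : 0 < s by rewrite (lt_le_trans _ s2)// invr_gt0.
    rewrite /expV s0 hornerE mul1r ler_expR lerN2 -[leRHS]invrK lef_pV2//.
    by rewrite posrE invr_gt0.
  move: t2; rewrite ler_norml => /andP[t1 t2].
  apply: ler_pM; rewrite ?expR_ge0//; apply: h; lra.
- move=> k.
  have [B [_ hB]] : bounded_set (F k @` `[(-1 : R), 1]).
    apply: compact_bounded; apply: continuous_compact; last exact: segment_compact.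
    exact: continuous_subspaceT.
  exists (Num.max 0 (B + 1)) => x; have [x1|x1] := leP `|x| 1.
    rewrite le_max; apply/orP; right; apply: hB; first by rewrite ltrDl.
    by exists x => //; rewrite /= in_itv/= -ler_norml.
  by rewrite F0// normr0 le_max lexx.
Unshelve. all: by end_near. Qed.

End bump.

(** * Product functions, polynomials and test functions *)

Section product_functions.
Context {R : realType} {n : nat}.
Implicit Types (x : 'rV[R]_n) (s : seq 'I_n) (i : 'I_n).

Lemma differentiable_prod (J : Type) (r : seq J) (F : J -> 'rV[R]_n -> R) x :
  (forall a, differentiable (F a) x) ->
  differentiable (fun y => \prod_(a <- r) F a y) x.
Proof.
move=> dF; elim: r => [|a r IH].
  by under eq_fun do rewrite big_nil; exact: differentiable_cst.
under eq_fun do rewrite big_cons.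
exact: (@differentiableM _ _ (F a)).
Qed.

Lemma differentiable_lincomb (J : Type) (r : seq J) (c : J -> R)
    (F : J -> 'rV[R]_n -> R) x :
  (forall a, differentiable (F a) x) ->
  differentiable (fun y => \sum_(a <- r) c a * F a y) x.
Proof.
move=> dF; elim: r => [|a r IH].
  by under eq_fun do rewrite big_nil; exact: differentiable_cst.
under eq_fun do rewrite big_cons.
apply: (@differentiableD _ _ _ (fun y => c a * F a y)) => //.
exact: (@differentiableZ _ _ _ (F a) (c a)).
Qed.

Lemma partial_lincomb (J : Type) (r : seq J) (c : J -> R)
    (F : J -> 'rV[R]_n -> R) i :
  (forall a x, differentiable (F a) x) ->
  partial i (fun y => \sum_(a <- r) c a * F a y) =
  (fun y => \sum_(a <- r) c a * partial i (F a) y).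
Proof.
move=> dF; apply/funext => x; rewrite /partial; elim: r => [|a r IH].
  by under eq_fun do rewrite big_nil; rewrite big_nil derive_cst.
under eq_fun do rewrite big_cons.
rewrite big_cons -IH (@deriveD _ _ _ (fun y => c a * F a y)).
- by rewrite (@deriveZ _ _ _ (F a) (c a))//; exact: diff_derivable.
- by apply: diff_derivable; exact: (@differentiableZ _ _ _ (F a) (c a)).
- by apply: diff_derivable; exact: differentiable_lincomb.
Qed.

(** For towers [f i] this is D^k of the tensor product of the functions [f i 0]; the family is
    stable under [partial], which raises one entry of [k]. *)
Definition prodfun (f : 'I_n -> nat -> R -> R) (k : 'I_n -> nat) x : R :=
  \prod_i f i (k i) (x 0 i).

Section towers.
Variable f : 'I_n -> nat -> R -> R.
Hypothesis df : forall i, derivative_tower (f i).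

Lemma differentiable_prodfun k x : differentiable (prodfun f k) x.
Proof.
apply: differentiable_prod => i.
apply: (@differentiable_comp _ _ _ _ (fun y : 'rV[R]_n => y 0 i) (f i (k i))).
  exact: differentiable_coord.
by apply/derivable1_diffP; have := df i (k i) (x 0 i) => h; exact: ex_derive.
Qed.

Lemma partial_prodfun i k :
  partial i (prodfun f k) = prodfun f (fun l => k l + (l == i))%N.
Proof.
apply/funext => x.
pose P := \prod_(l | l != i) f l (k l) (x 0 l).
have E (h : R) : prodfun f k (h *: delta_mx 0 i + x) =
    (fun t : R => P * f i (k i) t) (h *: (1 : R) + x 0 i).
  rewrite /prodfun (bigD1 i)//= mulrC !mxE !eqxx; congr (_ * f i (k i) (_ + _)).
  by apply: eq_bigr => l li; rewrite !mxE (negbTE li) andbF mulr0 add0r.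
rewrite /partial; have [-> _] := eq_growth_rate (g := fun t : R => P * f i (k i) t) E.
have := df i (k i) (x 0 i) => h.
have := @is_deriveZ _ _ _ _ P _ _ _ h => h'.
rewrite (@derive_val _ _ _ _ _ _ _ h').
rewrite /prodfun (bigD1 i)//= eqxx addn1 mulrC; congr (_ * _).
by apply: eq_bigr => l li; rewrite (negbTE li) addn0.
Qed.

Lemma foldr_partial_prodfun s k :
  foldr partial (prodfun f k) s = prodfun f (fun l => k l + count_mem l s)%N.
Proof.
elim: s => [|i s IH] /=; first by congr prodfun; apply/funext => l; rewrite addn0.
rewrite IH partial_prodfun; congr prodfun; apply/funext => l.
by rewrite -addnA [(_ + (l == i))%N]addnC eq_sym.
Qed.

Lemma smooth_prodfun k : smooth (prodfun f k).
Proof. by move=> s x; rewrite foldr_partial_prodfun; exact: differentiable_prodfun. Qed.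

End towers.

Definition monomial_tower (a k : nat) (t : R) : R := ('X^a)^`(k).[t].

Lemma monomial_towerP a : derivative_tower (monomial_tower a).
Proof. by move=> k t; rewrite /monomial_tower derivnS; exact: is_derive_poly. Qed.

(** The same coefficients [c] serve for every [s], and [s] enters only through its counts.
    Smoothness and independence of the order of differentiation both follow from this form. *)
Lemma foldr_partial_poly r (q : 'rV[R]_n -> R) : poly_lt r q ->
  exists c : {ffun 'I_n -> 'I_r} -> R, forall s, foldr partial q s =
    fun x => \sum_a c a * prodfun (fun i => monomial_tower (a i)) (fun l => count_mem l s) x.
Proof.
move=> [c qE]; exists c; elim=> [|i s IH] /=.
  apply/funext => x; rewrite qE; apply: eq_bigr => a _; congr (_ * _).
  by apply: eq_bigr => i _; rewrite /monomial_tower/= hornerXn.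
rewrite IH partial_lincomb; last first.
  by move=> a x; apply: differentiable_prodfun => l; exact: monomial_towerP.
apply/funext => x; apply: eq_bigr => a _; congr (_ * _).
rewrite partial_prodfun; last by move=> l; exact: monomial_towerP.
by congr prodfun; apply/funext => l; rewrite addnC eq_sym.
Qed.

Lemma poly_smooth r (q : 'rV[R]_n -> R) : poly_lt r q -> smooth q.
Proof.
move=> /foldr_partial_poly[c qE] s x; rewrite qE; apply: differentiable_lincomb => a.
by apply: differentiable_prodfun => l; exact: monomial_towerP.
Qed.

(* Integrating by parts one derivative at a time reverses their order; on
   products of functions of one variable partial derivatives commute. *)
Lemma foldr_partial_poly_rev r (q : 'rV[R]_n -> R) s : poly_lt r q ->
  foldr partial q (rev s) = foldr partial q s.
Proof.
move=> /foldr_partial_poly[c qE]; rewrite !qE; apply/funext => x.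
apply: eq_bigr => a _; congr (_ * prodfun _ _ x).
by apply/funext => l; rewrite count_rev.
Qed.

End product_functions.

Section test_functions.
Context {R : realType} {n : nat}.
Implicit Types (x : 'rV[R]_n) (s : seq 'I_n) (i : 'I_n) (f q psi : 'rV[R]_n -> R).
Implicit Types (U : set 'rV[R]_n).

Lemma smooth_foldr f s : smooth f -> smooth (foldr partial f s).
Proof. by move=> sf s' x; rewrite -foldr_cat; exact: sf. Qed.

Lemma smooth_partial f i : smooth f -> smooth (partial i f).
Proof. exact: (@smooth_foldr f [:: i]). Qed.

Lemma smooth_differentiable f x : smooth f -> differentiable f x.
Proof. by move=> /(_ [::] x). Qed.

Lemma smooth_continuous f : smooth f -> continuous f.
Proof.
by move=> sf x; apply: differentiable_continuous; exact: smooth_differentiable.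
Qed.

Lemma foldr_partial_eq0 f s M : (forall x, M < `|x| -> f x = 0) ->
  forall x, M < `|x| -> foldr partial f s x = 0.
Proof. by move=> f0; elim: s => [//|i s IH]; exact: partial_eq0_far. Qed.

Lemma integrable_continuousM q psi M : continuous q -> continuous psi ->
  (forall x, M < `|x| -> psi x = 0) ->
  (lebesgue_rV n).-integrable setT (fun x => (q x * psi x)%:E).
Proof.
move=> cq cpsi psi0.
have cqpsi : continuous (fun x => q x * psi x).
  by move=> x; apply: (@continuousM _ _ q psi); [exact: cq|exact: cpsi].
have qpsi0 x : M < `|x| -> q x * psi x = 0 by move=> /psi0 ->; rewrite mulr0.
have [B hB] := continuous_far_bounded cqpsi qpsi0.
apply: (bounded_support_integrable _ hB qpsi0).
exact: continuous_measurable_rV.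
Qed.

(** Product rule: [partial i (q * psi)] integrates to 0, as the product inherits the bounded support
    of [psi]. *)
Lemma integral_by_parts q psi i M : smooth q -> smooth psi ->
  (forall x, M < `|x| -> psi x = 0) ->
  (\int[lebesgue_rV n]_x (q x * partial i psi x)%:E =
   - \int[lebesgue_rV n]_x (partial i q x * psi x)%:E)%E.
Proof.
move=> sq spsi psi0.
have dE : partial i (q * psi) = fun x => q x * partial i psi x + partial i q x * psi x.
  apply/funext => x; rewrite /partial deriveM; try exact/diff_derivable/smooth_differentiable.
  by congr (_ + _); exact: mulrC.
have i1 := integrable_continuousM (smooth_continuous sq)
  (smooth_continuous (@smooth_partial psi i spsi)) (@partial_eq0_far _ _ i _ _ psi0).
have i2 := integrable_continuousM (smooth_continuous (@smooth_partial q i sq))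
  (smooth_continuous spsi) psi0.
have : (\int[lebesgue_rV n]_x (partial i (q * psi)%R x)%:E = 0)%E.
  apply: (@integral_partial_eq0 _ _ _ _ M).
  - move=> x; apply: derivableM; exact/diff_derivable/smooth_differentiable.
  - rewrite dE => x.
    apply: (@continuousD _ _ _ (fun x => q x * partial i psi x)
      (fun x => partial i q x * psi x)).
      by apply: (@continuousM _ _ q (partial i psi)); apply: smooth_continuous => //;
        exact: smooth_partial.
    by apply: (@continuousM _ _ (partial i q) psi); apply: smooth_continuous => //;
      exact: smooth_partial.
  - by move=> x Mx; rewrite /GRing.mul/= psi0// mulr0.
rewrite dE; under eq_integral do rewrite EFinD.
rewrite integralD//.
have := integrable_fin_num measurableT i1; have := integrable_fin_num measurableT i2.
move=> /fineK <- /fineK <-; rewrite -EFinD => -[] /eqP.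
by rewrite addr_eq0 => /eqP ->; rewrite EFinN.
Qed.

Lemma integral_foldr_by_parts q psi s M : smooth q -> smooth psi ->
  (forall x, M < `|x| -> psi x = 0) ->
  (\int[lebesgue_rV n]_x (q x * foldr partial psi s x)%:E =
   ((-1) ^+ size s)%:E *
   \int[lebesgue_rV n]_x (foldr partial q (rev s) x * psi x)%:E)%E.
Proof.
move=> sq spsi psi0; elim: s q sq => [|i s IH] q sq /=; first by rewrite mul1e.
rewrite (integral_by_parts (M := M) i sq (@smooth_foldr psi s spsi)).
  rewrite (IH _ (@smooth_partial q i sq)) rev_cons -cats1 foldr_cat/=.
  by rewrite exprS mulN1r EFinN mulNe.
exact: foldr_partial_eq0.
Qed.

Lemma test_function_sub U V psi : U `<=` V -> test_function U psi -> test_function V psi.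
Proof. by move=> UV [spsi cpsi sU]; split => //; exact: subset_trans UV. Qed.

(** The complement of a closed support is open, so the function vanishes near each of its points,
    and hence so do its partial derivatives. *)
Lemma support_foldr_partial f s :
  closure [set x | foldr partial f s x != 0] `<=` closure [set x | f x != 0].
Proof.
elim: s => [//|i s IH] /=; apply: subset_trans IH.
set g := foldr partial f s.
apply: (@subset_trans _ (closure (closure [set x | g x != 0]))); last first.
  by rewrite -(closure_id _).1//; exact: closed_closure.
apply: closureS => x /= gx; apply: contrapT => nx.
have : \forall y \near x, ~ closure [set x | g x != 0] y.
  apply: open_nbhs_nbhs; split => //; exact/closed_openC/closed_closure.
move=> h; move/eqP : gx; apply.
rewrite (@partial_near_eq _ _ _ _ (cst 0)); first by rewrite /partial derive_cst.
near=> y; apply: contrapT => /eqP gy.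
have : ~ closure [set x | g x != 0] y by near: y.
by apply; exact: subset_closure.
Unshelve. all: by end_near. Qed.

Lemma test_function_foldr U psi s :
  test_function U psi -> test_function U (foldr partial psi s).
Proof.
move=> [spsi cpsi sU]; split.
- exact: smooth_foldr.
- apply: subclosed_compact cpsi _; [exact: closed_closure|exact: support_foldr_partial].
- by apply: subset_trans sU; exact: support_foldr_partial.
Qed.

Lemma test_function_eq0 U psi x : test_function U psi -> ~ U x -> psi x = 0.
Proof.
move=> [_ _ sU] Ux; apply: contrapT => /eqP px; apply: Ux; apply: sU.
exact: subset_closure.
Qed.

Lemma test_function_far U psi : test_function U psi ->
  exists M, forall x, M < `|x| -> psi x = 0.
Proof.
move=> [_ /compact_bounded[M [_ hM]] _]; exists (M + 1) => x Mx.
apply: contrapT => /eqP px.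
have px' : closure [set x | psi x != 0] x by exact: subset_closure.
have := hM (M + 1) _ x px'; rewrite ltrDl => /(_ ltr01)/=.
by rewrite leNgt Mx.
Qed.

End test_functions.

(** * Approximation of Borel sets by finite unions of boxes *)

Section threshold_approximation.
Context {R : realType} {n : nat}.
Implicit Types (x y : 'rV[R]_n) (s : seq R) (A B : set 'rV[R]_n).

(** The label of the grid cell containing [x]. It lives in a finite type, so the thresholds [s] cut
    space into finitely many cells. *)
Definition pattern s x : {ffun 'I_n -> (size s).-tuple bool} :=
  [ffun i => map_tuple (fun t => x 0 i < t) (in_tuple s)].

Lemma patternP s x y : reflect (forall i t, t \in s -> (x 0 i < t) = (y 0 i < t))
  (pattern s x == pattern s y).
Proof.
apply: (iffP eqP) => [xy i t ts|xy].
  have : tval (pattern s x i) = tval (pattern s y i) by rewrite xy.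
  by rewrite !ffunE/= => /eq_in_map/(_ t ts).
apply/ffunP => i; rewrite !ffunE; apply: val_inj => /=.
by apply/eq_in_map => t ts; exact: xy.
Qed.

(* B is a union of the boxes cut out by the hyperplanes x_i = t, t in s. *)
Definition saturated s B := forall x y, pattern s x = pattern s y -> B x -> B y.

Lemma saturated_sub s s' B : {subset s <= s'} -> saturated s B -> saturated s' B.
Proof.
move=> ss' sB x y /eqP/patternP xy; apply: sB; apply/eqP/patternP => i t ts.
exact/xy/ss'.
Qed.

Variable m : {finite_measure set 'rV[R]_n -> \bar R}.

(** Both differences are controlled because integrals over [A] and [B] will be compared.
    Measurability is carried along for the induction over the generated sigma-algebra. *)
Definition approximable A := measurable A /\ forall e : R, 0 < e ->
  exists s B, [/\ measurable B, saturated s B,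
    (m (A `\` B) < e%:E)%E & (m (B `\` A) < e%:E)%E].

Lemma approximableC A : approximable A -> approximable (~` A).
Proof.
move=> [mA hA]; split; first exact: measurableC.
move=> e e0; have [s [B [mB sB AB BA]]] := hA e e0.
exists s, (~` B); split.
- exact: measurableC.
- by move=> x y xy nBx By; apply: nBx; exact: (sB y x).
- by rewrite setDE setCK setIC -setDE.
- by rewrite setDE setCK setIC -setDE.
Qed.

Lemma approximableU A A' : approximable A -> approximable A' -> approximable (A `|` A').
Proof.
move=> [mA hA] [mA' hA']; split; first exact: measurableU.
move=> e e0; have e2 : 0 < e / 2 by rewrite divr_gt0.
have [s [B [mB sB AB BA]]] := hA _ e2; have [s' [B' [mB' sB' AB' BA']]] := hA' _ e2.
exists (s ++ s'), (B `|` B'); split.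
- exact: measurableU.
- move=> x y xy [Bx|Bx]; [left|right].
    by apply: (@saturated_sub s (s ++ s') B _ sB x y) => // t ts; rewrite mem_cat ts.
  by apply: (@saturated_sub s' (s ++ s') B' _ sB' x y) => // t ts; rewrite mem_cat ts orbT.
- apply: (@le_lt_trans _ _ (m ((A `\` B) `|` (A' `\` B')))).
    apply: le_measure; rewrite ?inE; [| |move=> x [[Ax|Ax] nB]; [left|right]].
    + by apply: measurableD; exact: measurableU.
    + by apply: measurableU; exact: measurableD.
    + by split=> // Bx; apply: nB; left.
    + by split=> // Bx; apply: nB; right.
  apply: le_lt_trans (measureU2 _ _ _) _; [exact: measurableD|exact: measurableD|].
  by rewrite [e]splitr EFinD lteD.
- apply: (@le_lt_trans _ _ (m ((B `\` A) `|` (B' `\` A')))).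
    apply: le_measure; rewrite ?inE; [| |move=> x [[Ax|Ax] nB]; [left|right]].
    + by apply: measurableD; exact: measurableU.
    + by apply: measurableU; exact: measurableD.
    + by split=> // Bx; apply: nB; left.
    + by split=> // Bx; apply: nB; right.
  apply: le_lt_trans (measureU2 _ _ _) _; [exact: measurableD|exact: measurableD|].
  by rewrite [e]splitr EFinD lteD.
Qed.

Lemma approximable0 : approximable set0.
Proof.
split=> // e e0; exists [::], set0; split => //.
- by rewrite setD0 measure0 lte_fin.
- by rewrite setD0 measure0 lte_fin.
Qed.

(** The finite unions [H k] exhaust the union and, [m] being finite, the remainders [D k] decrease
    to measure 0. Half of [e] pays for the remainder, half for approximating one [H k]. *)
Lemma approximable_bigcup (F : nat -> set 'rV[R]_n) :
  (forall k, approximable (F k)) -> approximable (\bigcup_k F k).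
Proof.
move=> aF; have mF k : measurable (F k) by have [] := aF k.
have mU : measurable (\bigcup_k F k) by exact: bigcupT_measurable.
split=> // e e0; have e2 : 0 < e / 2 by rewrite divr_gt0.
pose H k := \big[setU/set0]_(i < k) F i.
have aH k : approximable (H k).
  elim: k => [|k IH]; first by rewrite /H big_ord0; exact: approximable0.
  by rewrite /H big_ord_recr; exact: approximableU.
have HU k : H k `<=` \bigcup_k F k by exact: bigsetU_bigcup.
pose D k := (\bigcup_k F k) `\` H k.
have mD k : measurable (D k) by apply: measurableD => //; have [] := aH k.
have D0 : \bigcap_k D k = set0.
  rewrite -subset0 => x Dx; have [[k _ Fkx] _] := Dx 0%N I.
  have [_] := Dx k.+1 I; apply; rewrite /H big_ord_recr; right; exact: Fkx.
have cvD : m \o D @ \oo --> 0%E.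
  have := @nonincreasing_cvg_mu _ _ _ m D; rewrite D0 measure0; apply => //.
  - by rewrite ltey_eq fin_num_measure.
  - apply/nonincreasing_seqP => k; apply/subsetPset => x [Ux nH]; split => // Hx.
    by apply: nH; rewrite /H big_ord_recr; left.
have [k Dk] : exists k, (m (D k) < (e / 2)%:E)%E.
  near \oo => k; exists k; near: k.
  apply: (cvD [set z | (z < (e / 2)%:E)%E]).
  by apply: open_nbhs_nbhs; split; [exact: open_ereal_lt_ereal|rewrite /= lte_fin].
have [_ /(_ _ e2)[s [B [mB sB AB BA]]]] := aH k.
exists s, B; split => //.
- apply: (@le_lt_trans _ _ (m (D k `|` (H k `\` B)))).
    apply: le_measure; rewrite ?inE; [exact: measurableD| |].
      by apply: measurableU => //; apply: measurableD => //; have [] := aH k.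
    move=> x [Ux nB]; have [Hx|nH] := pselect (H k x); first by right.
    by left.
  apply: le_lt_trans (measureU2 _ _ _) _ => //.
    by apply: measurableD => //; have [] := aH k.
  by rewrite [e]splitr EFinD lteD.
- apply: (@le_lt_trans _ _ (m (B `\` H k))).
    apply: le_measure; rewrite ?inE; [exact: measurableD| |].
      by apply: measurableD => //; have [] := aH k.
    by move=> x [Bx nU]; split => // /HU.
  by rewrite (lt_trans BA)// lte_fin ltr_pdivrMr// ltr_pMr// ltr1n.
Unshelve. all: by end_near. Qed.

(* The approximable sets form a sigma-algebra containing the half-spaces. *)
Lemma measurable_approximable A : measurable A -> approximable A.
Proof.
(* Stated for preimages because it is used twice: with the identity and with a coordinate map. *)
have sig (T : Type) (f : 'rV[R]_n -> T) :
    sigma_algebra setT [set Y | approximable (f @^-1` Y)].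
  split => /=.
  - by rewrite preimage_set0; exact: approximable0.
  - by move=> Y aY; rewrite setTD preimage_setC; exact: approximableC.
  - by move=> Y aY; rewrite preimage_bigcup; exact: approximable_bigcup.
apply: smallest_sub; first exact: (sig _ id).
rewrite -bigcup_seq => _ [i _ [Y mY <-]]; rewrite setTI /=.
move: Y mY; rewrite (RGenInftyO.measurableE R).
apply: smallest_sub; first exact: (sig _ (fun x : 'rV[R]_n => x 0 i)).
move=> _ [t ->] /=.
have mt : measurable [set x : 'rV[R]_n | (x 0 i : measurableTypeR R) \in `]-oo, t[].
  have := @measurable_rV_coor R n i measurableT `]-oo, t[%classic (measurable_itv _).
  by rewrite setTI.
split => // e e0; exists [:: t], ((fun x : 'rV[R]_n => x 0 i) @^-1` `]-oo, t[%classic); split => //.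
- move=> x y /eqP/patternP/(_ i t); rewrite mem_head => /(_ isT).
  by rewrite /= !in_itv/= => ->.
- by rewrite setDv measure0 lte_fin.
- by rewrite setDv measure0 lte_fin.
Qed.

End threshold_approximation.

(** * Concentration of a nonzero function on a box *)

Section cells.
Context {R : realType} {n : nat}.
Implicit Types (x y : 'rV[R]_n) (s : seq R) (A B D : set 'rV[R]_n) (f : 'rV[R]_n -> R).
Local Notation leb := (@lebesgue_rV R n).

Definition box (J : 'I_n -> set R) : set 'rV[R]_n := [set x | forall i, J i (x 0 i)].

Lemma measurable_interval_box J : (forall i, is_interval (J i)) -> measurable (box J).
Proof.
by move=> iJ; apply: (@measurable_box _ _ J) => i; exact: is_interval_measurable.
Qed.

(** A saturated set is the disjoint union of the finitely many cells inside it. A cell is a box with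
    interval sides, because prescribing all comparisons with the thresholds is a convex condition on
    a coordinate. *)
Lemma integral_saturated_ge0 s B f :
  measurable_fun setT f -> saturated s B ->
  (forall J : 'I_n -> set R, (forall i, is_interval (J i)) ->
    (0 <= \int[leb]_(x in box J) (f x)%:E)%E) ->
  (0 <= \int[leb]_(x in B) (f x)%:E)%E.
Proof.
move=> mf sB f0.
pose J (p : {ffun 'I_n -> (size s).-tuple bool}) i : set R :=
  [set a | [seq a < t | t <- s] = tval (p i)].
pose cell p := box (J p).
have iJ p i : is_interval (J p i).
  move=> a b Ja Jb c /andP[ac cb]; rewrite /J/= -Ja; apply/eq_in_map => t ts.
  have /eq_in_map/(_ t ts) : [seq a < t | t <- s] = [seq b < t | t <- s] by rewrite Ja Jb.
  move=> h; apply/idP/idP => [ct|]; first exact: le_lt_trans ct.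
  by rewrite h; exact: le_lt_trans.
have cellE p x : cell p x <-> pattern s x = p.
  split=> [h|<- i]; last by rewrite /J/= ffunE.
  by apply/ffunP => i; rewrite ffunE; apply: val_inj; exact: h.
have mcell p : measurable (cell p).
  exact: measurable_interval_box.
pose F p := if `[< cell p `<=` B >] then cell p else set0.
have mF p : measurable (F p) by rewrite /F; case: ifP.
have -> : B = \big[setU/set0]_(p <- index_enum {ffun 'I_n -> (size s).-tuple bool}) F p.
  rewrite -bigcup_seq; apply/seteqP; split=> [x Bx|x [p _]]; last first.
    by rewrite /F; case: ifPn => // /asboolP; apply.
  exists (pattern s x) => /=; first by rewrite mem_index_enum.
  rewrite /F ifT; first exact/cellE.
  by apply/asboolP => y /cellE xy; exact: (sB x y).
rewrite integral_bigsetU_EFin//; first last.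
- exact/measurable_EFinP/measurable_funTS.
- apply/trivIsetP => p q _ _ pq; rewrite -subset0 => x [].
  rewrite /F; case: ifP => // _ /cellE px; case: ifP => // _ /cellE qx.
  by move/eqP : pq; apply; rewrite -px.
- exact: index_enum_uniq.
apply: sume_ge0 => p _; rewrite /F; case: ifP => _; last by rewrite integral_set0.
exact: f0.
Qed.

(** Absolute continuity of the integral bounds the error of replacing [A] by a saturated [B].
    Approximation requires a finite measure: Lebesgue measure is restricted to [D], off which [f]
    vanishes. *)
Lemma integral_cells_ge0 D f A : measurable D -> (leb D < +oo)%E ->
  leb.-integrable setT (EFin \o f) -> (forall x, ~ D x -> f x = 0) ->
  (forall J : 'I_n -> set R, (forall i, is_interval (J i)) ->
    (0 <= \int[leb]_(x in box J) (f x)%:E)%E) ->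
  measurable A -> (0 <= \int[leb]_(x in A) (f x)%:E)%E.
Proof.
move=> mD Doo intf fD fJ mA.
have mf : measurable_fun setT f by case/integrableP : (intf) => /measurable_EFinP.
pose m : {finite_measure set 'rV[R]_n -> \bar R} := mfrestr mD Doo.
have intfS C : measurable C -> leb.-integrable C (EFin \o f).
  by move=> mC; exact: integrableS intf.
have fin C : measurable C -> (\int[leb]_(x in C) (f x)%:E)%E \is a fin_num.
  by move=> mC; apply: integrable_fin_num => //; exact: intfS.
(* The integral over A is that over B, minus the part over B minus A, plus the part over A minus B;
   each of these two parts is at most e in absolute value. *)
suff h (e : R) : 0 < e -> (- (e + e)%:E <= \int[leb]_(x in A) (f x)%:E)%E.
  have := fineK (fin _ mA); set I := fine _ => IE.
  rewrite -IE lee_fin leNgt; apply/negP => I0.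
  have I4 : 0 < - I / 4 by rewrite divr_gt0// oppr_gt0.
  by have := h _ I4; rewrite -[X in (_ <= X)%E]IE -EFinN lee_fin; lra.
move=> e0; have [d [d0 hd]] := integral_normr_continuous intf e0.
have [_ /(_ _ d0)[s [B [mB sB AB BA]]]] := measurable_approximable m mA.
have IB := integral_saturated_ge0 mf sB fJ.
have small C : measurable C -> (m C < d%:E)%E -> (`| \int[leb]_(x in C) (f x)%:E | <= e%:E)%E.
  move=> mC Cd.
  have -> : (\int[leb]_(x in C) (f x)%:E = \int[leb]_(x in C `&` D) (f x)%:E)%E.
    rewrite integral_mkcond [RHS]integral_mkcond; apply: eq_integral => x _.
    rewrite !patchE in_setI; case: (x \in C) => //=; case: ifPn => // /negP.
    by rewrite inE => /fD ->.
  have mCD : measurable (C `&` D) by exact: measurableI.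
  apply: le_trans (le_abse_integral _ _ _) _ => //; first by case/integrableP : (intfS _ mCD).
  have := hd _ mCD Cd; rewrite /Rintegral -lte_fin fineK; first exact: ltW.
  apply: integrable_fin_num => //; exact: (integrable_abse (intfS _ mCD)).
have split C C' : measurable C -> measurable C' -> (\int[leb]_(x in C) (f x)%:E =
   \int[leb]_(x in C `&` C') (f x)%:E + \int[leb]_(x in C `\` C') (f x)%:E)%E.
  move=> mC mC'; rewrite -integral_setU//; first by rewrite setUIDK.
  - exact: measurableI.
  - exact: measurableD.
  - exact/measurable_EFinP/measurable_funTS.
  - by apply/disj_setPS => x [[_ C'x] [_]].
have mAB : measurable (A `\` B) by exact: measurableD.
have mBA : measurable (B `\` A) by exact: measurableD.
have := small _ mAB AB; have := small _ mBA BA.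
move: IB; rewrite (split B A)// (split A B)// [B `&` A]setIC.
rewrite -(fineK (fin _ (measurableI _ _ mA mB))) -(fineK (fin _ mAB)) -(fineK (fin _ mBA)).
rewrite -!EFinD -EFinN !lee_fin !ler_norml.
by move=> h1 /andP[h2 h3] /andP[h4 h5]; lra.
Qed.


(** A bounded nonempty box with intervals of unknown type as sides lies between [obox] and [cbox]
    taken at the infima and suprema of its sides. *)
Definition obox (l u : 'rV[R]_n) : set 'rV[R]_n := [set x | forall i, l 0 i < x 0 i < u 0 i].
Definition cbox (l u : 'rV[R]_n) : set 'rV[R]_n := [set x | forall i, l 0 i <= x 0 i <= u 0 i].

Let cside (l u : 'rV[R]_n) i : set (measurableTypeR R) := `[l 0 i, u 0 i]%classic.

Let cboxE l u : cbox l u = [set x | forall i, cside l u i (x 0 i)].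
Proof.
by apply/seteqP; split=> x h i; have := h i; rewrite /cside/= in_itv.
Qed.

Lemma measurable_cbox l u : measurable (cbox l u).
Proof. by rewrite cboxE; apply: measurable_box => i; exact: measurable_itv. Qed.

Lemma measurable_obox l u : measurable (obox l u).
Proof.
pose A i : set (measurableTypeR R) := `]l 0 i, u 0 i[%classic.
rewrite (_ : obox l u = [set x | forall i, A i (x 0 i)]).
  by apply: measurable_box => i; exact: measurable_itv.
by apply/seteqP; split=> x h i; have := h i; rewrite /A/= in_itv.
Qed.

Lemma lebesgue_rV_cbox (l u : 'rV[R]_n) : (forall i, l 0 i <= u 0 i) ->
  leb (cbox l u) = (\prod_i (u 0 i - l 0 i))%:E.
Proof.
move=> lu; rewrite cboxE.
have -> := @lebesgue_rV_box R n (cside l u); last by move=> i; exact: measurable_itv.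
rewrite -prodEFin; apply: eq_bigr => i _.
rewrite /cside lebesgue_measure_itv/= lte_fin -EFinB; case: ltP => // h.
by congr EFin; apply/eqP; rewrite eq_sym subr_eq0 eq_le h lu.
Qed.

Lemma obox_sub_cbox l u : obox l u `<=` cbox l u.
Proof. by move=> x h i; have /andP[h1 h2] := h i; rewrite !ltW. Qed.

Lemma compact_cube (c : 'rV[R]_n) e : compact (cube c e).
Proof.
pose A i : set R := `[c 0 i - e, c 0 i + e]%classic.
rewrite (_ : cube c e = [set x | forall i, A i (x ord0 i)]).
  by apply: (@rV_compact _ _ A) => i; exact: segment_compact.
by apply/seteqP; split=> x h i; have := h i; rewrite /A/= in_itv/= ler_distl.
Qed.

(** Each point of G with g nonzero lies in a rational cube inside G and satisfies the inequality for
    some rational a. There are countably many such choices; were all the resulting sets null, g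
    would vanish almost everywhere on G. *)
Lemma ae_neq0_deviation (G : set 'rV[R]_n) (g : 'rV[R]_n -> R) (eps : R) :
  open G -> measurable_fun G g ->
  ~ leb.-negligible [set x | G x /\ g x != 0] -> 0 < eps ->
  exists (c : 'rV[R]_n) (e a : R), [/\ a != 0, 0 < e, cube c e `<=` G &
    (0 < leb (cube c e `&` [set x | (`|g x - a| <= eps * `|a|)%R]))%E].
Proof.
move=> oG mg gn0 eps0; apply: contrapT => hn; apply: gn0.
pose cen (z : 'rV[rat]_n) : 'rV[R]_n := map_mx ratr z.
pose P (z : 'rV[rat]_n * nat * rat) :=
  [/\ ratr z.2 != 0 :> R & cube (cen z.1.1) (z.1.2.+1%:R^-1) `<=` G].
pose S (z : 'rV[rat]_n * nat * rat) := cube (cen z.1.1) (z.1.2.+1%:R^-1) `&`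
  [set x | `|g x - ratr z.2| <= eps * `|ratr z.2| ].
pose F k : set 'rV[R]_n :=
  if choice.unpickle k is Some z then (if `[< P z >] then S z else set0) else set0.
have mG : measurable G by exact: open_measurable_rV.
have negF k : leb.-negligible (F k).
  rewrite /F; case: (choice.unpickle k) => [z|]; last exact: negligible_set0.
  case: ifPn => [/asboolP[z0 zG]|_]; last exact: negligible_set0.
  have mS : measurable (S z).
    have -> : S z = cube (cen z.1.1) (z.1.2.+1%:R^-1) `&` (G `&`
      [set x | `|g x - ratr z.2| <= eps * `|ratr z.2| ]).
      by rewrite setIA (setIidl zG).
    apply: measurableI; first exact: measurable_cube.
    have mgz : measurable_fun G (fun x => `|g x - ratr z.2|).
      by apply: measurableT_comp => //; exact: measurable_funB.
    have := mgz mG `]-oo, (eps * `|ratr z.2|)]%classic (measurable_itv _).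
    congr measurable; apply/seteqP; split=> x [Gx] /=; rewrite ?in_itv/=; by split.
  exists (S z); split => //; apply/eqP; rewrite eq_le measure_ge0 andbT leNgt.
  by apply/negP => Sz; apply: hn; exists (cen z.1.1), (z.1.2.+1%:R^-1), (ratr z.2).
apply: (@negligibleS _ _ _ _ (\bigcup_k F k)); last exact: negligible_bigcup.
move=> x [Gx gx].
have /nbhs_ballP[d /= d0 dG] : nbhs x G by move/open_nbhs_nbhs : (conj oG Gx).
have [k kd] : exists k : nat, k.+1%:R^-1 < d / 2.
  have d2 : 0 < d / 2 by rewrite divr_gt0.
  near \oo => k; exists k.
  by near: k; exact: near_infty_natSinv_lt (PosNum d2).
have k0 : 0 < k.+1%:R^-1 :> R by rewrite invr_gt0.
have rx i : {q : rat | `|ratr q - x 0 i| < k.+1%:R^-1 :> R}.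
  have lt2 : x 0 i - k.+1%:R^-1 < x 0 i + k.+1%:R^-1 by rewrite ltrD2l gt0_cp.
  have /cid[q] := rat_in_itvoo lt2.
  by rewrite in_itv/= => qx; exists q; rewrite ltr_distl.
(* The first bound forces |a| >= |g x| / 2, hence a != 0; the second then gives |g x - a| <= eps
   |a|. *)
pose eta := Num.min (`|g x| / 2) (eps * `|g x| / 2).
have gx0 : 0 < `|g x| by rewrite normr_gt0.
have eta0 : 0 < eta by rewrite lt_min !divr_gt0// mulr_gt0.
have [a ag] : exists a : rat, `|g x - ratr a| < eta.
  have lt2 : g x - eta < g x + eta by rewrite ltrD2l gt0_cp.
  have [q] := rat_in_itvoo lt2.
  by rewrite in_itv/= => qx; exists q; rewrite distrC ltr_distl.
have : `|g x - ratr a| < `|g x| / 2 by rewrite (lt_le_trans ag)// ge_min lexx.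
have : `|g x - ratr a| < eps * `|g x| / 2 by rewrite (lt_le_trans ag)// ge_min lexx orbT.
have := ler_normD (g x - ratr a) (ratr a); rewrite subrK => h1 h2 h3.
have ga : `|g x| / 2 <= `|ratr a : R| by lra.
pose z : 'rV[rat]_n := \row_i sval (rx i).
exists (choice.pickle (z, k, a)); first exact: I.
rewrite /F choice.pickleK ifT.
- split=> [i|/=].
    rewrite /cen !mxE distrC; exact/ltW/(svalP (rx i)).
  by rewrite (le_trans (ltW h2))// -mulrA ler_wpM2l// ltW.
- apply/asboolP; split => /=; first by rewrite -normr_gt0 (lt_le_trans _ ga)// divr_gt0.
  move=> y hy; apply: dG; rewrite -ball_normE; apply/rV_norm_ltP => // i.
  have := hy i; rewrite /cen !mxE => {}hy; have := svalP (rx i) => /=.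
  rewrite [X in X < _ -> _]distrC => hx.
  rewrite (le_lt_trans (ler_distD (ratr (sval (rx i))) (x 0 i) (y 0 i)))// [d]splitr.
  by rewrite ltrD// ?(lt_trans hx)// distrC (le_lt_trans hy).
Unshelve. all: by end_near. Qed.

Lemma integrable_cst_lty (D : set 'rV[R]_n) (b : R) :
  measurable D -> (leb D < +oo)%E -> leb.-integrable D (EFin \o cst b).
Proof.
move=> mD Doo; apply: measurable_bounded_integrable => //.
exists `|b|; split; first exact: num_real.
by move=> y by' x _ /=; exact: ltW.
Qed.

(* Otherwise |g - a| - eps |a| would have a nonnegative integral over every box,
   hence over every Borel subset of the cube c, e, in particular over the subset
   of positive measure on which it is at most - eps |a| / 2. *)
Lemma integral_concentration (G : set 'rV[R]_n) (g : 'rV[R]_n -> R) (eps : R) : open G ->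
  loc_integrable G g ->
  ~ leb.-negligible [set x | G x /\ g x != 0] -> 0 < eps ->
  exists (l u : 'rV[R]_n) (a : R), [/\ a != 0, forall i, l 0 i < u 0 i,
    cbox l u `<=` G &
    (\int[leb]_(x in obox l u) (`|g x - a|)%:E <=
      (eps * `|a| * \prod_i (u 0 i - l 0 i))%:E)%E].
Proof.
move=> oG [mg ig] gn0 eps0.
have eps2 : 0 < eps / 2 by rewrite divr_gt0.
have [c [e [a [a0 e0 cG Apos]]]] := ae_neq0_deviation oG mg gn0 eps2.
pose D := cube c e; have mD : measurable D by exact: measurable_cube.
have Doo : (leb D < +oo)%E by rewrite lebesgue_rV_cube ?ltry// ltW.
have iga : leb.-integrable D (EFin \o (fun x => `|g x - a|)).
  have := ig _ (@compact_cube c e) cG => igD.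
  have ica : leb.-integrable D (EFin \o cst a) by exact: integrable_cst_lty.
  exact: (integrable_abse (integrableB mD igD ica)).
have icst : leb.-integrable D (EFin \o cst (eps * `|a|)).
  exact: integrable_cst_lty.
pose f0 x := `|g x - a| - eps * `|a|.
have if0 : leb.-integrable D (EFin \o f0) by exact: (integrableB mD iga icst).
pose f := f0 \_ D.
have intf : leb.-integrable setT (EFin \o f).
  by rewrite /f -restrict_EFin; apply/(integrable_mkcond _ mD).
have fD x : ~ D x -> f x = 0 by move=> Dx; rewrite /f patchE memNset.
pose A := D `&` [set x | `|g x - a| <= eps / 2 * `|a| ].
have mA : measurable A.
  have mga : measurable_fun D (fun x => `|g x - a|).
    by case/integrableP : (iga) => /measurable_EFinP.
  have := mga mD `]-oo, (eps / 2 * `|a|)]%classic (measurable_itv _).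
  congr measurable; apply/seteqP; split=> x [Gx] /=; rewrite ?in_itv/=; by split.
have [J [iJ IJ]] : exists J : 'I_n -> set R, (forall i, is_interval (J i)) /\
    (\int[leb]_(x in box J) (f x)%:E < 0)%E.
  apply: contrapT => hn.
  have : (0 <= \int[leb]_(x in A) (f x)%:E)%E.
    apply: (integral_cells_ge0 mD Doo intf fD) => // J iJ.
    by rewrite leNgt; apply/negP => IJ; apply: hn; exists J.
  apply/negP; rewrite -ltNge.
  apply: (@le_lt_trans _ _ (\int[leb]_(x in A) (- (eps / 2 * `|a|))%:E)%E).
    apply: le_integral => //.
    - exact: integrableS intf.
    - apply: integrable_cst_lty => //.
      by rewrite (le_lt_trans _ Doo)// le_measure ?inE//; exact: subIsetl.
    - move=> x; rewrite inE => -[Dx /= hx]; rewrite lee_fin /f patchE mem_set// /f0.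
      lra.
  rewrite integral_cst// EFinN mulNe oppe_lt0 mule_gt0//.
  by rewrite lte_fin mulr_gt0// normr_gt0.
(* As f vanishes off the cube D, cutting the sides down to those of D preserves the integral and
   bounds the sides, so that their infima and suprema are meaningful. *)
pose J' i := J i `&` `[c 0 i - e, c 0 i + e]%classic.
have iJ' i : is_interval (J' i).
  move=> s t [Js +] [Jt +] r /andP[sr rt]; rewrite /= !in_itv/= => /andP[h1 h2] /andP[h3 h4].
  split; first by apply: (iJ i s t) => //; rewrite sr rt.
  by rewrite /= in_itv/= (le_trans h1 sr) (le_trans rt h4).
have mQ : measurable (box J') by exact: measurable_interval_box.
have QD : box J' `<=` D.
  by move=> x h i; have [_] := h i; rewrite /= in_itv/= ler_distl.
have {}IJ : (\int[leb]_(x in box J') (f x)%:E < 0)%E.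
  rewrite (_ : box J' = box J `&` D).
    move: IJ; rewrite [X in (X < _)%E -> _]integral_mkcond [X in _ -> (X < _)%E]integral_mkcond.
    congr (_ < _)%E; apply: eq_integral => x _; rewrite !patchE in_setI.
    case: (x \in box J) => //=; case: ifPn => // /negP.
    by rewrite inE => /fD ->.
  apply/seteqP; split=> [x h|x [h1 h2] i].
    by split; [move=> i; have [] := h i|exact: QD].
  by split; [exact: h1|have := h2 i; rewrite /= in_itv/= ler_distl].
(* A negative integral requires positive measure: the box is nonempty and, later, no side is
   degenerate. *)
have Q0 : leb (box J') != 0%E.
  apply/eqP => Q0; move: IJ; rewrite null_set_integral ?ltxx//.
  have [] := integrableP _ _ _ intf.
  by move=> /measurable_EFinP mf _; exact/measurable_EFinP/measurable_funTS.
have [x0 Qx0] : box J' !=set0.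
  by apply/set0P/eqP => E; move/eqP : Q0; apply; rewrite E measure0.
pose l : 'rV[R]_n := \row_i inf (J' i); pose u : 'rV[R]_n := \row_i sup (J' i).
have hlb i : has_lbound (J' i) by exists (c 0 i - e) => t [_]; rewrite /= in_itv/= => /andP[].
have hub i : has_ubound (J' i) by exists (c 0 i + e) => t [_]; rewrite /= in_itv/= => /andP[].
have Jn0 i : J' i !=set0 by exists (x0 0 i).
have Qlu : box J' `<=` cbox l u.
  move=> x h i; rewrite !mxE; apply/andP; split.
    by apply: ge_inf => //; exact: h.
  by apply: ub_le_sup => //; exact: h.
have luQ : obox l u `<=` box J'.
  move=> x h i; have := h i; rewrite !mxE => /andP[h1 h2].
  have [s Js sx] := inf_lt (Jn0 i) h1.
  have [t Jt xt] := sup_gt (Jn0 i) h2.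
  by apply: (iJ' i s t) => //; rewrite !ltW.
have lu i : l 0 i <= u 0 i by have /andP[] := Qlu _ Qx0 i; exact: le_trans.
have luc : cbox l u `<=` D.
  move=> x h i; have := h i; rewrite !mxE => /andP[h1 h2]; rewrite ler_distl.
  apply/andP; split.
    apply: le_trans h1; apply: lb_le_inf => // t [_].
    by rewrite /= in_itv/= => /andP[].
  apply: le_trans h2 _; apply: ge_sup => // t [_].
  by rewrite /= in_itv/= => /andP[].
have Qle : (leb (box J') <= (\prod_i (u 0 i - l 0 i))%:E)%E.
  by rewrite -lebesgue_rV_cbox// le_measure// inE//; exact: measurable_cbox.
exists l, u, a; split => //.
- have P0 : 0 < \prod_i (u 0 i - l 0 i).
    rewrite -lte_fin (lt_le_trans _ Qle)// lt_neqAle eq_sym Q0/=; exact: measure_ge0.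
  move=> i; rewrite lt_neqAle lu andbT; apply/eqP => E.
  by move: P0; rewrite (bigD1 i)//= E subrr mul0r ltxx.
- by apply: subset_trans cG; exact: luc.
- apply: (@le_trans _ _ (\int[leb]_(x in box J') (`|g x - a|)%:E)%E).
    apply: ge0_subset_integral => //; first exact: measurable_obox.
    apply: (measurable_funS mD QD); by case/integrableP : iga.
  have : (\int[leb]_(x in box J') (f x)%:E =
     \int[leb]_(x in box J') (`|g x - a|)%:E - (eps * `|a|)%:E * leb (box J'))%E.
    rewrite -integral_cst// -integralB//.
    + by apply: eq_integral => x /[!inE] /QD Dx; rewrite /f patchE mem_set.
    + exact: integrableS iga.
    + exact: integrableS icst.
  have Qfin : leb (box J') \is a fin_num.
    by rewrite ge0_fin_numE ?measure_ge0// (le_lt_trans Qle)// ltry.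
  move=> E; move: IJ; rewrite E sube_lt0 => [IJ|].
    apply: (le_trans (ltW IJ)); rewrite -(fineK Qfin) -EFinM lee_fin ler_wpM2l//.
      by rewrite mulr_ge0// ltW.
    by rewrite -lee_fin fineK.
  by rewrite (@fin_numM _ _ (leb (box J')))// orbT.
Qed.

End cells.

(** * Weak derivatives on an element *)

Section multi_indices.
Context {R : realType} {n : nat}.
Implicit Types (a : 'I_n -> nat) (f : 'rV[R]_n -> R) (i : 'I_n).

(* The order in which mpartial differentiates: a prefix of this sorted sequence
   is again the sequence of a multi-index, so that D^a splits as D^b D^(a - b)
   without exchanging partial derivatives. *)
Definition mseq a : seq 'I_n := flatten [seq nseq (a i) i | i <- enum 'I_n].

Lemma mpartialE a f : mpartial a f = foldr partial f (mseq a).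
Proof.
rewrite /mpartial /mseq; elim: (enum 'I_n) => //= i l ->.
by rewrite foldr_cat; elim: (a i) => //= k ->.
Qed.

Lemma size_mseq a : size (mseq a) = mindex_deg a.
Proof.
rewrite /mseq size_flatten /shape -map_comp /mindex_deg sumnE big_map.
rewrite big_enum /=; apply: eq_bigr => i _; exact: size_nseq.
Qed.

Lemma count_mseq a i : count_mem i (mseq a) = a i.
Proof.
rewrite /mseq count_flatten -map_comp sumnE big_map big_enum /= (bigD1 i)//=.
rewrite count_nseq /= eqxx mul1n big1 ?addn0// => j ji.
by rewrite count_nseq /= (negbTE ji).
Qed.

Let leqo (i j : 'I_n) := (i <= j)%N.

Let leqo_trans : transitive leqo. Proof. by move=> ? ? ?; exact: leq_trans. Qed.

Lemma mseq_sorted a : sorted leqo (mseq a).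
Proof.
rewrite sorted_pairwise// /mseq.
have : pairwise leqo (enum 'I_n).
  rewrite -sorted_pairwise//; have := iota_sorted 0 n.
  by rewrite -val_enum_ord sorted_map.
elim: (enum 'I_n) => //= i l IH /andP[il /IH pl].
rewrite pairwise_cat pl andbT; apply/andP; split.
  apply/allrelP => j k; rewrite mem_nseq => /andP[_ /eqP ->].
  move=> /flattenP[s' /mapP[i' i'l ->]]; rewrite mem_nseq => /andP[_ /eqP ->].
  exact: (allP il).
elim: (a i) => //= k ->; rewrite andbT.
by apply/allP => j; rewrite mem_nseq => /andP[_ /eqP ->]; rewrite /leqo.
Qed.

(** A prefix of a sorted sequence is sorted, and a sorted sequence is determined by its counts.
    Those of the prefix are at most its length j, so [inord] into ['I_j.+1] loses nothing. *)
Lemma mseq_take a j : (j <= mindex_deg a)%N ->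
  exists2 b : {ffun 'I_n -> 'I_j.+1}, mindex_deg (mindex b) = j &
    mseq (mindex b) = take j (mseq a).
Proof.
move=> ja; pose s := take j (mseq a).
have sj : size s = j by rewrite size_take_min size_mseq; exact/minn_idPl.
pose b : {ffun 'I_n -> 'I_j.+1} := [ffun i => inord (count_mem i s)].
have bE i : mindex b i = count_mem i s.
  by rewrite /mindex ffunE inordK// ltnS -[X in (_ <= X)%N]sj; exact: count_size.
have sE : mseq (mindex b) = s.
  apply: (sorted_eq leqo_trans).
  - by move=> x y; rewrite /leqo -eqn_leq => /eqP/val_inj.
  - exact: mseq_sorted.
  - apply: (subseq_sorted leqo_trans (take_subseq _ _)); exact: mseq_sorted.
  - by apply/allP => i _; rewrite /= count_mseq bE.
by exists b => //; rewrite -size_mseq sE.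
Qed.

End multi_indices.

Section bump_on_cube.
Context {R : realType} {n : nat}.

Lemma sum_count_mem (s : seq 'I_n) : (\sum_i count_mem i s)%N = size s.
Proof.
elim: s => [|i s IH] /=; first by rewrite big1.
rewrite big_split /= IH (bigD1 i)//= eqxx big1 ?addn0// => j ji.
by rewrite eq_sym (negbTE ji).
Qed.

(** All bumps are translates and dilates of one product of n one-dimensional bumps, so the constants
    do not depend on [c] and [e], and each derivative costs a factor 1/e. The n factors explain the
    powers [m ^+ n] and [B ^+ n]. *)
Lemma cube_bump (r : nat) : exists2 m : R, 0 < m & exists2 M : R, 0 < M &
  forall (c : 'rV[R]_n) (e : R), 0 < e -> exists phi : 'rV[R]_n -> R,
  [/\ forall U, cube c e `<=` U -> test_function U phi,
      forall x, 0 <= phi x <= 1,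
      forall x, ~ cube c e x -> phi x = 0,
      forall x, cube c (e / 2) x -> m <= phi x &
      forall s, (size s <= r)%N -> forall x,
        `|foldr partial phi s x| <= M * e ^- size s].
Proof.
have [F [tF F0 F01 [m m0 Fm] FB]] := @bump_tower R.
have [B B0 hB] : exists2 B, 0 < B & forall k, (k <= r)%N -> forall t, `|F k t| <= B.
  elim: r => [|r [B B0 hB]].
    have [B hB] := FB 0%N; exists (Num.max B 1); first by rewrite lt_max ltr01 orbT.
    by move=> k; rewrite leqn0 => /eqP -> t; rewrite le_max hB.
  have [B' hB'] := FB r.+1; exists (Num.max B B'); first by rewrite lt_max B0.
  move=> k; rewrite leq_eqVlt => /orP[/eqP -> t|]; first by rewrite le_max hB' orbT.
  by rewrite ltnS => kr t; rewrite le_max hB.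
exists (m ^+ n); first exact: exprn_gt0.
exists (B ^+ n); first exact: exprn_gt0.
move=> c e e0.
pose f (i : 'I_n) (k : nat) (t : R) := e^-1 ^+ k * F k (e^-1 * t + - (e^-1 * c 0 i)).
have tf i : derivative_tower (f i) by exact: tower_affine.
have arg i x : e^-1 * x + - (e^-1 * c 0 i) = (x - c 0 i) / e.
  by rewrite -mulrBr mulrC.
have nrm (x : R) : `|x / e| = `|x| / e by rewrite normrM [X in _ * X]gtr0_norm ?invr_gt0.
pose phi := prodfun f (fun=> 0%N).
have phi0 x : ~ cube c e x -> phi x = 0.
  move=> /existsNP[i /negP]; rewrite -ltNge => hi.
  rewrite /phi /prodfun (bigD1 i)//= /f arg F0 ?mulr0 ?mul0r//.
  by rewrite nrm ltr_pdivlMr// mul1r.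
have supp : closure [set x | phi x != 0] `<=` cube c e.
  rewrite [X in _ `<=` X](_ : _ = closure (cube c e)).
    by apply: closureS => x /= px; apply: contrapT => /phi0/eqP; rewrite (negbTE px).
  apply/closure_id; apply: compact_closed; first exact: norm_hausdorff.
  exact: compact_cube.
exists phi; split => //.
- move=> U cU; split.
  + exact: smooth_prodfun.
  + apply: subclosed_compact supp; [exact: closed_closure|exact: compact_cube].
  + exact: subset_trans supp cU.
- move=> x; apply/andP; split.
    apply: prodr_ge0 => i _; rewrite /f expr0 mul1r.
    by have /andP[] := F01 (e^-1 * x 0 i + - (e^-1 * c 0 i)).
  by apply: prodr_ile1 => i _; rewrite /f expr0 mul1r.
- move=> x hx; rewrite -[n in m ^+ n]card_ord -prodr_const.
  apply: ler_prod => i _; rewrite ltW//= /f expr0 mul1r arg Fm// nrm.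
  by rewrite ler_pdivrMr// mulrC hx.
- move=> s sr x; rewrite foldr_partial_prodfun//.
  rewrite normr_prod /f /=.
  under eq_bigr => i _ do rewrite add0n normrM normrX (gtr0_norm (_ : 0 < e^-1)) ?invr_gt0//.
  rewrite big_split/= prodrXr sum_count_mem mulrC exprVn ler_wpM2r//.
    by rewrite invr_ge0 exprn_ge0// ltW.
  rewrite -[n in B ^+ n]card_ord -prodr_const; apply: ler_prod => i _.
  rewrite normr_ge0/= hB//; apply: leq_trans sr; exact: count_size.
Qed.

End bump_on_cube.

Section weak_derivatives.
Context {R : realType} {n : nat}.
Implicit Types (U G : set 'rV[R]_n) (w v g h psi : 'rV[R]_n -> R) (a : 'I_n -> nat).
Local Notation leb := (@lebesgue_rV R n).

Lemma continuous_loc_integrable U g : continuous g -> loc_integrable U g.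
Proof.
move=> cg; split; first by apply: measurable_funTS; exact: continuous_measurable_rV.
move=> A cA _; have mA := compact_measurable_rV cA.
have [M [_ hM]] : bounded_set (g @` A).
  by apply: compact_bounded; apply: continuous_compact => //; exact: continuous_subspaceT.
have [N [_ hN]] := compact_bounded cA.
apply: measurable_bounded_integrable => //.
- apply: (@le_lt_trans _ _ (leb (cube 0 `|N + 1|))).
    apply: le_measure; rewrite ?inE//; first exact: measurable_cube.
    move=> x Ax i; rewrite mxE subr0 (le_trans (rV_coord_le _ _))//.
    by rewrite (le_trans _ (ler_norm _))// hN// ltrDl.
  by rewrite lebesgue_rV_cube// ltry.
- by apply: measurable_funTS; exact: continuous_measurable_rV.
- exists (M + 1); split; first exact: num_real.
  move=> y My x Ax /=; apply: hM; last by exists x.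
  by rewrite (lt_trans _ My)// ltrDl.
Qed.

Lemma loc_integrable_eq U w v : (forall x, U x -> w x = v x) ->
  loc_integrable U w -> loc_integrable U v.
Proof.
move=> wv [mw iw]; split.
  by apply: eq_measurable_fun mw => x /[!inE]; exact: wv.
move=> A cA AU; apply: eq_integrable (iw _ cA AU) => //.
  exact: compact_measurable_rV.
by move=> x /[!inE] /AU Ux /=; rewrite wv.
Qed.

Lemma loc_integrableB U w v : loc_integrable U w -> loc_integrable U v ->
  loc_integrable U (w \- v).
Proof.
move=> [mw iw] [mv iv]; split; first exact: measurable_funB.
move=> A cA AU.
exact: (integrableB (compact_measurable_rV cA) (iw _ cA AU) (iv _ cA AU)).
Qed.

Lemma loc_integrable_sub U G w : open U -> open G -> U `<=` G ->
  loc_integrable G w -> loc_integrable U w.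
Proof.
move=> oU oG UG [mw iw]; split.
  by apply: measurable_funS mw => //; exact: open_measurable_rV.
by move=> A cA AU; apply: iw => //; exact: subset_trans UG.
Qed.

(** The product vanishes off the compact support of [psi], on which [w] is integrable and [psi]
    bounded. *)
Lemma integrable_test U w psi : open U -> loc_integrable U w ->
  test_function U psi -> leb.-integrable U (fun x => (w x * psi x)%:E).
Proof.
move=> oU [mw iw] tpsi; have [spsi cS SU] := tpsi.
set S := closure _ in cS SU.
have mU := open_measurable_rV oU; have mS := compact_measurable_rV cS.
have cpsi := smooth_continuous spsi.
have [M psiM] := test_function_far tpsi.
have [B hB] := continuous_far_bounded cpsi psiM.
have intS : leb.-integrable S (fun x => (w x * psi x)%:E).
  have iwS := iw _ cS SU.
  have mpsi : measurable_fun S psi by apply: measurable_funTS; exact: continuous_measurable_rV.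
  have bpsi : [bounded psi x | x in S].
    exists B; split; first exact: num_real.
    by move=> y By x _ /=; exact: le_trans (hB x) (ltW By).
  exact: (integrableMl mS iwS mpsi bpsi).
apply/(integrable_mkcond _ mU); move/(integrable_mkcond _ mS) : intS.
congr (_.-integrable _ _); apply/funext => x; rewrite !patchE.
have [Sx|Sx] := pselect (S x); first by rewrite !mem_set//; exact: SU.
rewrite (memNset Sx); case: ifPn => // _.
suff -> : psi x = 0 by rewrite mulr0.
by apply: contrapT => /eqP px; apply: Sx; exact: subset_closure.
Qed.

Lemma integral_vanish_sub U G (F : 'rV[R]_n -> \bar R) : U `<=` G ->
  (forall x, ~ U x -> F x = 0%E) ->
  (\int[leb]_(x in G) F x = \int[leb]_(x in U) F x)%E.
Proof.
move=> UG F0; rewrite integral_mkcond [RHS]integral_mkcond.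
apply: eq_integral => x _; rewrite !patchE.
have [Ux|Ux] := pselect (U x); first by rewrite !mem_set//; exact: UG.
by rewrite (memNset Ux) F0//; case: ifP.
Qed.

Lemma weak_deriv_sub U G a w g : open U -> open G -> U `<=` G ->
  is_weak_deriv G a w g -> is_weak_deriv U a w g.
Proof.
move=> oU oG UG [lw lg wg]; split; try exact: loc_integrable_sub UG _.
move=> phi tphi; have := wg _ (test_function_sub UG tphi).
rewrite (integral_vanish_sub UG); last first.
  move=> x Ux; rewrite mpartialE.
  by rewrite (test_function_eq0 (test_function_foldr _ tphi) Ux) mulr0.
rewrite (integral_vanish_sub UG)// => x Ux.
by rewrite (test_function_eq0 tphi Ux) mulr0.
Qed.

(** Test functions vanish off U, so v can be replaced by q and the integrals extended to the whole
    space, where classical integration by parts applies. *)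
Lemma weak_deriv_poly U a r (q : 'rV[R]_n -> R) v : open U -> poly_lt r q ->
  (forall x, U x -> v x = q x) -> is_weak_deriv U a v (mpartial a q).
Proof.
move=> oU pq vq; have sq := poly_smooth pq; split.
- apply: (@loc_integrable_eq _ q); first by move=> x /vq.
  by apply: continuous_loc_integrable; exact: smooth_continuous.
- apply: continuous_loc_integrable; apply: smooth_continuous.
  by rewrite mpartialE; exact: smooth_foldr.
move=> phi tphi; have [M phiM] := test_function_far tphi.
have [sphi _ _] := tphi.
have vE x : (v x * mpartial a phi x = q x * mpartial a phi x)%R.
  have [/vq ->//|Ux] := pselect (U x).
  by rewrite mpartialE (test_function_eq0 (test_function_foldr _ tphi) Ux) !mulr0.
under eq_integral do rewrite vE.
rewrite -(@integral_vanish_sub U setT)//; last first.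
  by move=> x Ux; rewrite (test_function_eq0 tphi Ux) mulr0.
rewrite -(@integral_vanish_sub U setT)//; last first.
  move=> x Ux; rewrite mpartialE.
  by rewrite (test_function_eq0 (test_function_foldr _ tphi) Ux) mulr0.
under eq_integral do rewrite mpartialE.
rewrite (integral_foldr_by_parts _ sq sphi phiM) size_mseq; congr (_ * _)%E.
by under eq_integral do rewrite (foldr_partial_poly_rev _ pq) -mpartialE.
Qed.

Lemma weak_derivB U a w v g h : open U -> is_weak_deriv U a w g ->
  is_weak_deriv U a v h -> is_weak_deriv U a (w \- v) (g \- h).
Proof.
move=> oU [lw lg wg] [lv lh vh]; split; try exact: loc_integrableB.
move=> phi tphi; have mU := open_measurable_rV oU.
have tD : test_function U (mpartial a phi).
  by rewrite mpartialE; exact: test_function_foldr.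
under eq_integral do rewrite /= mulrBl EFinB.
under [in RHS]eq_integral do rewrite /= mulrBl EFinB.
rewrite !integralB//; try exact: integrable_test.
have hfin := integrable_fin_num mU (integrable_test oU lh tphi).
rewrite (wg _ tphi) (vh _ tphi); apply/esym/muleBr => //.
by apply: fin_num_adde_defl; rewrite fin_numN.
Qed.

Lemma foldr_partial_eq_open U (f g : 'rV[R]_n -> R) s : open U ->
  (forall x, U x -> f x = g x) ->
  forall x, U x -> foldr partial f s x = foldr partial g s x.
Proof.
move=> oU fg; elim: s => [//|i s IH] /= x Ux; apply: partial_near_eq.
by near do apply: IH; exact: open_nbhs_nbhs.
Unshelve. all: by end_near. Qed.

Lemma wderiv_element G U r a u v : open G -> open U -> U `<=` G ->
  (exists2 q, poly_lt r q & forall x, U x -> v x = q x) ->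
  (exists h, is_weak_deriv G a u h) ->
  is_weak_deriv U a (u \- v) (wderiv U a (u \- v)).
Proof.
move=> oG oU UG [q pq vq] [h uh]; rewrite /wderiv; apply: getPex.
exists (h \- mpartial a q); apply: weak_derivB => //; first exact: weak_deriv_sub UG uh.
exact: weak_deriv_poly pq vq.
Qed.

(** The integral of (u - v) D^gamma phi is evaluated twice: moving all derivatives onto u - v leaves
    g, as D^gamma v = 0; moving only the first j of [mseq gamma] leaves the others on phi. Absolute
    values discard the two signs. *)
Lemma integral_test_element G U r gamma j (b : {ffun 'I_n -> 'I_j.+1}) u v g phi :
  open G -> open U -> U `<=` G ->
  (exists2 q, poly_lt r q & forall x, U x -> v x = q x) ->
  (forall x, U x -> mpartial gamma v x = 0) ->
  is_weak_deriv G gamma u g ->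
  (exists h, is_weak_deriv G (mindex b) u h) ->
  mseq (mindex b) = take j (mseq gamma) ->
  test_function U phi ->
  (`| \int[leb]_(x in U) (g x * phi x)%:E | =
   `| \int[leb]_(x in U) (wderiv U (mindex b) (u \- v) x *
        foldr partial phi (drop j (mseq gamma)) x)%:E |)%E.
Proof.
move=> oG oU UG vpoly Dv ug uh bE tphi.
have [_ _ Ew] := wderiv_element oG oU UG vpoly uh.
have [q pq vq] := vpoly.
have [_ _ Eg] := weak_derivB oU (weak_deriv_sub oU oG UG ug) (weak_deriv_poly gamma oU pq vq).
have tpsi := test_function_foldr (drop j (mseq gamma)) tphi.
have := Ew _ tpsi; rewrite mpartialE bE -foldr_cat cat_take_drop -mpartialE (Eg _ tphi).
have -> : (\int[leb]_(x in U) ((g \- mpartial gamma q)%R x * phi x)%:E =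
           \int[leb]_(x in U) (g x * phi x)%:E)%E.
  apply: eq_integral => x /[!inE] Ux /=; rewrite [X in _ - X](_ : _ = 0) ?subr0//.
  rewrite -[RHS](Dv _ Ux) !mpartialE; apply: (foldr_partial_eq_open _ oU) => // y Uy.
  by rewrite vq.
move=> /(congr1 abse); rewrite !abseM.
by rewrite !abse_EFin !normrX normrN1 !expr1n !mul1e.
Qed.

End weak_derivatives.

(** * Geometry of an element *)

Section element_geometry.
Context {R : realType} {n : nat}.
Implicit Types (x y c : 'rV[R]_n) (K : set 'rV[R]_n).

Lemma coord_le_enorm x i : `|x 0 i| <= enorm x.
Proof.
rewrite /enorm -sqrtr_sqr ler_sqrt; last by apply: sumr_ge0 => j _; exact: sqr_ge0.
by rewrite (bigD1 i)//= lerDl sumr_ge0// => j _; exact: sqr_ge0.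
Qed.

Lemma enorm_le x (e : R) : 0 <= e -> (forall i, `|x 0 i| <= e) -> enorm x <= n%:R * e.
Proof.
move=> e0 xe; rewrite /enorm -[leRHS]ger0_norm ?mulr_ge0// -sqrtr_sqr.
rewrite ler_sqrt ?sqr_ge0//.
apply: (@le_trans _ _ (\sum_(i < n) e ^+ 2)).
  by apply: ler_sum => i _; rewrite -real_normK ?num_real// ler_sqr ?nnegrE.
rewrite sumr_const card_ord exprMn -[leLHS]mulr_natl ler_wpM2r ?sqr_ge0//.
by rewrite -natrX ler_nat; case: (n) => // k; rewrite expnS expn1 leq_pmulr.
Qed.

Lemma enorm_axis (i : 'I_n) (t : R) : 0 <= t -> enorm (t *: delta_mx 0 i : 'rV[R]_n) = t.
Proof.
move=> t0; rewrite /enorm (bigD1 i)//= big1 ?addr0; last first.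
  by move=> j ji; rewrite !mxE (negbTE ji) andbF mulr0 expr0n.
by rewrite !mxE !eqxx mulr1 sqrtr_sqr ger0_norm.
Qed.

Lemma polytope_bounded K : polytope K -> exists2 M : R, 0 <= M &
  forall x i, K x -> `|x 0 i| <= M.
Proof.
move=> [s ->]; exists (\sum_(k < size s) `|s`_k|); first by apply: sumr_ge0.
move=> x i [w [w0 w1 ->]]; apply: le_trans (rV_coord_le _ _) _.
apply: le_trans (ler_norm_sum _ _ _) _; apply: ler_sum => k _.
rewrite normrZ ger0_norm// ler_piMl//.
by rewrite -w1 (bigD1 k)//= lerDl sumr_ge0.
Qed.

Section one_element.
Variables (K : set 'rV[R]_n) (hK : polytope K).

(** A real [sup] is an upper bound only of a bounded set; boundedness comes from the vertices. *)
Lemma diam_ge x y : K x -> K y -> enorm (x - y) <= diam K.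
Proof.
move=> Kx Ky; have [M M0 hM] := polytope_bounded hK.
apply: ub_le_sup; last by exists x => //; exists y.
exists (n%:R * (M + M)) => _ [a Ka] [b Kb] <-.
apply: enorm_le => [|i]; first by rewrite addr_ge0.
by rewrite !mxE (le_trans (ler_normB _ _))// lerD// hM.
Qed.

Hypotheses (n0 : (0 < n)%N) (K0 : K° !=set0).

Let D := [set d | 0 <= d /\ exists c, [set x | enorm (x - c) <= d / 2] `<=` K].

(** A ball of diameter d contains two points at distance d along a coordinate axis. Hence the
    supremum defining [indiam] is that of a bounded set. *)
Let D_le_diam d : D d -> d <= diam K.
Proof.
move=> [d0 [c cK]]; pose i := Ordinal n0.
have h (s : R) : `|s| <= d / 2 -> K (c + s *: delta_mx 0 i).
  move=> sd; apply: cK => /=; rewrite addrC addrA addNr add0r.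
  have [s0|s0] := leP 0 s; first by rewrite enorm_axis// -[X in X <= _]ger0_norm.
  rewrite -[s]opprK scaleNr /enorm.
  under eq_bigr do rewrite mxE sqrrN.
  rewrite -/(enorm (- s *: delta_mx 0 i : 'rV[R]_n)) enorm_axis ?oppr_ge0 ?(ltW s0)//.
  by rewrite -ltr0_norm.
have d2 : 0 <= d / 2 by rewrite divr_ge0.
have := diam_ge (h (d / 2) _) (h (- (d / 2)) _).
rewrite normrN ger0_norm// lexx => /(_ isT isT).
rewrite scaleNr opprD opprK addrACA subrr add0r -scalerDl -splitr.
by rewrite enorm_axis.
Qed.

Lemma indiam_gt0 : 0 < indiam K.
Proof.
have [c /nbhs_ballP[e /= e0 eK]] := K0.
apply: (lt_le_trans e0); apply: ub_le_sup.
  by exists (diam K) => d /D_le_diam.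
split; [exact: ltW|exists c => x /= xc; apply: eK; rewrite -ball_normE].
rewrite /= distrC; apply/rV_norm_ltP => // i.
apply: le_lt_trans (coord_le_enorm _ _) _; apply: le_lt_trans xc _.
by rewrite ltr_pdivrMr// ltr_pMr// ltr1n.
Qed.

Lemma diam_gt0 : 0 < diam K.
Proof.
apply: lt_le_trans indiam_gt0 _; apply: ge_sup; last by move=> d /D_le_diam.
apply: contrapT => /set0P/negP; rewrite negbK => /eqP E.
by have := indiam_gt0; rewrite /indiam E sup0 ltxx.
Qed.

(** As h <= beta diam K < beta sigma indiam K, some inscribed ball has diameter d > h / (beta
    sigma). It contains the concentric cube of half side d / (2 n), since [enorm] is at most n times
    the sup norm. Halving that cube leaves room for a neighbourhood of each point, which puts it in
    the interior. *)
Lemma element_cube (h sigma beta : R) : 0 < h -> 0 < sigma -> 0 < beta ->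
  diam K / indiam K < sigma -> h / diam K <= beta ->
  exists c, cube c (h / (4 * n%:R * beta * sigma)) `<=` K°.
Proof.
move=> h0 s0 b0 hs hb; have d0 := diam_gt0; have i0 := indiam_gt0.
have nR : 0 < n%:R :> R by rewrite ltr0n.
have : h / (beta * sigma) < sup D.
  rewrite ltr_pdivrMr ?mulr_gt0//; move: hs hb.
  rewrite ltr_pdivrMr// ler_pdivrMr// => hs hb.
  by apply: le_lt_trans hb _; rewrite mulrA [_ * beta]mulrC -mulrA ltr_pM2l// mulrC.
have Dn0 : D !=set0.
  apply: contrapT => /set0P/negP; rewrite negbK => /eqP E.
  by move: i0; rewrite /indiam -/D E sup0 ltxx.
move=> /(sup_gt Dn0)[d [_ [c cK]] hd].
exists c => x xc; set e := h / _ in xc.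
have e0 : 0 < e by rewrite /e divr_gt0// !mulr_gt0.
apply/nbhs_ballP; exists e => //= y; rewrite -ball_normE => /(rV_norm_ltP _ e0) xy.
apply: cK => /=.
have -> : d / 2 = n%:R * (d / (2 * n%:R)).
  by field; rewrite gt_eqF.
have e2 : e + e <= d / (2 * n%:R).
  rewrite (_ : e + e = h / (beta * sigma) / (2 * n%:R)).
    by rewrite ler_pM2r ?invr_gt0 ?mulr_gt0// ltW.
  by rewrite /e; field; rewrite !gt_eqF.
apply: enorm_le => [|i]; first by apply: le_trans e2; rewrite addr_ge0 ?ltW.
apply: le_trans e2; rewrite !mxE (le_trans (ler_distD (x 0 i) _ _))//.
by rewrite lerD ?xc// distrC; have := xy i; rewrite !mxE => /ltW.
Qed.

End one_element.

Lemma mesh_size_ge (T : {fset (set 'rV[R]_n)}) K : K \in T -> diam K <= mesh_size T.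
Proof. by move=> KT; exact: le_bigmax_seq. Qed.

End element_geometry.

(** * From the piecewise seminorms to an L1 bound *)

Section L1_bound.
Context {R : realType} {n : nat}.
Implicit Types (G K Q : set 'rV[R]_n) (T : {fset (set 'rV[R]_n)}) (w g : 'rV[R]_n -> R).
Local Notation leb := (@lebesgue_rV R n).

Lemma measurable_norm (D : set 'rV[R]_n) w : measurable_fun D w ->
  measurable_fun D (fun x => `|w x|).
Proof. by move=> mw; exact: (measurableT_comp (@normr_measurable R setT) mw). Qed.

(** The norm for p = +oo is by definition an essential supremum only when the whole space has
    positive measure. *)
Lemma lebesgue_rV_setT_gt0 : (0 < leb setT)%E.
Proof.
apply: (@lt_le_trans _ _ (leb (cube 0 1))); last first.
  by apply: le_measure; rewrite ?inE//; exact: measurable_cube.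
by rewrite lebesgue_rV_cube// lte_fin exprn_gt0// mulr1.
Qed.

Lemma Lp_norm_gt0_nonnegligible G p g : open G -> measurable_fun G g -> (1 <= p)%E ->
  (0 < Lp_norm G p g)%E -> ~ leb.-negligible [set x | G x /\ g x != 0].
Proof.
move=> oG mg p1 + neg; apply/negP; rewrite -leNgt /Lp_norm.
have mG := open_measurable_rV oG.
have mgG : measurable_fun setT (g \_ G) by apply/(measurable_restrictT _ mG).
have ae0 : {ae leb, forall x, (g \_ G) x = 0}.
  apply: negligibleS neg => x /=; rewrite patchE; case: ifPn; last by [].
  by rewrite inE => Gx /eqP.
case: p p1 => [q|_|//]; rewrite unlock.
- rewrite lee_fin => q1.
  have -> : (\int[leb]_x `| (EFin \o g \_ G) x | `^ q = 0)%E.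
    transitivity (\int[leb]_x (cst 0%E x : \bar R))%E; last exact: integral0.
    apply: ae_eq_integral => //.
      apply: (measurableT_comp (measurable_poweR q)).
      by apply: measurableT_comp => //; exact/measurable_EFinP.
    apply: filterS ae0 => x x0 _ /=; rewrite x0 normr0 powR0//.
    by rewrite gt_eqF// (lt_le_trans ltr01).
  by rewrite poweR0r// invr_eq0 gt_eqF// (lt_le_trans ltr01).
- rewrite lebesgue_rV_setT_gt0; apply/ess_supP.
  by apply: filterS ae0 => x x0 /=; rewrite x0 normr0.
Qed.

Lemma sum_integral_le (r : seq (set 'rV[R]_n)) (P : pred (set 'rV[R]_n)) Q
    (f : 'rV[R]_n -> \bar R) : uniq r ->
  (forall K L, K \in r -> L \in r -> K != L -> K° `&` L° = set0) ->
  (forall K, K \in r -> P K -> K° `<=` Q) -> measurable Q ->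
  measurable_fun Q f -> (forall x, Q x -> (0 <= f x)%E) ->
  (\sum_(K <- r | P K) \int[leb]_(x in K°) f x <= \int[leb]_(x in Q) f x)%E.
Proof.
move=> ur dis PQ mQ mf f0.
have mK (K : set 'rV[R]_n) : measurable K° by exact: open_measurable_rV (open_interior _).
have subQ : \big[setU/set0]_(K <- seq.filter P r) K° `<=` Q.
  rewrite -bigcup_seq => x [K /=]; rewrite mem_filter => /andP[PK Kr]; exact: PQ.
rewrite -big_filter -ge0_integral_bigsetU//=.
- by apply: ge0_subset_integral => //; exact: bigsetU_measurable.
- exact: filter_uniq.
- apply/trivIsetP => K L /=; rewrite !mem_filter => /andP[_ Kr] /andP[_ Lr].
  exact: dis.
- by apply: measurable_funS mf.
- by move=> x /subQ; exact: f0.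
Qed.

(* Replaces Hoelder's inequality, as the constant does not matter. *)
Lemma le_powR_young (s t q : R) : 0 < s -> 0 <= t -> 1 <= q ->
  t <= s + s / s `^ q * t `^ q.
Proof.
move=> s0 t0 q1; have sq0 : 0 < s `^ q by exact: powR_gt0.
have [ts|st] := leP t s.
  by rewrite (le_trans ts)// lerDl mulr_ge0 ?powR_ge0// divr_ge0 ?ltW.
apply: (@le_trans _ _ (s / s `^ q * t `^ q)); last by rewrite lerDr ltW.
have ts1 : 1 <= t / s by rewrite ler_pdivlMr// mul1r ltW.
have h : t / s <= (t / s) `^ q.
  by rewrite -[leLHS]powRr1 ?(le_trans ler01)//; exact: ler_powR.
have E : t `^ q = (t / s) `^ q * s `^ q.
  by rewrite -powRM ?divfK ?gt_eqF ?(ltW s0) ?(le_trans ler01 ts1).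
rewrite E mulrCA divfK ?gt_eqF//.
by rewrite -ler_pdivrMr// in h *; rewrite mulrC -ler_pdivrMl// mulrC.
Qed.

(** By [le_powR_young], |D^b w| <= s + s^(1 - q) |D^b w|^q. Summed over the elements, the first term
    gives s |Q| and the second at most s^(1 - q) s^q = s. For p = +oo the derivative is at most s
    almost everywhere and the second summand is slack. *)
Lemma seminorm_L1_bound j p G T w (s : R) (P : pred (set 'rV[R]_n)) Q
    (b : {ffun 'I_n -> 'I_j.+1}) :
  (1 <= p)%E -> 0 < s -> (pw_norm j p G T w < s%:E)%E -> mindex_deg (mindex b) = j ->
  (forall K (a : {ffun 'I_n -> 'I_j.+1}), K \in T -> K `<=` G ->
    mindex_deg (mindex a) = j -> measurable_fun K° (wderiv K° (mindex a) w)) ->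
  (forall K L, K \in T -> L \in T -> K != L -> K° `&` L° = set0) ->
  measurable Q -> (forall K, K \in T -> P K -> K `<=` G /\ K° `<=` Q) ->
  (\sum_(K <- T | P K) \int[leb]_(x in K°) `|wderiv K° (mindex b) w x|%:E
     <= s%:E * leb Q + s%:E)%E.
Proof.
move=> p1 s0 ws bj mw dis mQ PQ.
have mK (K : set 'rV[R]_n) : measurable K° by exact: open_measurable_rV (open_interior _).
have sumQ : (\sum_(K <- T | P K) leb K° <= leb Q)%E.
  have := @sum_integral_le T P Q (cst 1%E) (fset_uniq T) dis
    (fun K KT PK => (PQ K KT PK).2) mQ.
  rewrite integral_cst// mul1e => h.
  apply: le_trans (h _ _) => //.
  by apply: lee_sum => K _; rewrite integral_cst// mul1e.
have sumsQ : (\sum_(K <- T | P K) (s%:E * leb K°) <= s%:E * leb Q)%E.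
  by rewrite -ge0_sume_distrr// lee_wpmul2l// lee_fin ltW.
rewrite big_seq_cond; case: p p1 ws => [q|_|//].
- rewrite lee_fin => q1 ws.
  have q0 : 0 < q by exact: lt_le_trans q1.
  pose Y K : \bar R := (\int[leb]_(x in K°)
    (\sum_(a : {ffun 'I_n -> 'I_j.+1} | mindex_deg (mindex a) == j)
       `|wderiv K° (mindex a) w x| `^ q)%R%:E)%E.
  have Y0 K : (0 <= Y K)%E.
    apply: integral_ge0 => x _; rewrite lee_fin; apply: sumr_ge0 => a _; exact: powR_ge0.
  have Yle : (\sum_(K <- T | `[< K `<=` G >]) Y K <= (s `^ q)%:E)%E.
    set Z := (\sum_(K <- T | _) Y K)%E.
    have Z0 : (0 <= Z)%E by apply: sume_ge0 => K _; exact: Y0.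
    have ZE : ((Z `^ q^-1) `^ q = Z)%E.
      by rewrite -poweRrM mulVf ?poweRe1// gt_eqF.
    have := ws; rewrite /pw_norm; set X := (\sum_(i < j.+1) _)%E => Xs.
    have ZX : (Z <= X)%E.
      rewrite /X big_ord_recr /= -[leLHS]ZE leeDr//.
      by apply: sume_ge0 => i _; exact: poweR_ge0.
    apply: (le_trans ZX).
    have X0 : (0 <= X)%E by exact: le_trans ZX.
    have <- : ((X `^ q^-1) `^ q = X)%E.
      by rewrite -poweRrM mulVf ?poweRe1// gt_eqF.
    rewrite -poweR_EFin; apply: gt0_ler_poweR; rewrite ?(ltW q0) ?(ltW Xs)//.
      by rewrite in_itv/= poweR_ge0 leey.
    by rewrite in_itv/= lee_fin (ltW s0) leey.
  have sq0 : 0 < s `^ q by exact: powR_gt0.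
  have hK K : K \in T -> P K -> (\int[leb]_(x in K°) `|wderiv K° (mindex b) w x|%:E <=
      s%:E * leb K° + (s / s `^ q)%:E * Y K)%E.
    move=> KT PK; have [KG _] := PQ _ KT PK.
    have mpow (a : {ffun 'I_n -> 'I_j.+1}) : mindex_deg (mindex a) = j ->
        measurable_fun K° (fun x => `|wderiv K° (mindex a) w x| `^ q).
      move=> aj; apply: (measurableT_comp (measurable_powR q)).
      by apply: measurable_norm; exact: mw.
    have mY : measurable_fun K° (fun x =>
      (\sum_(a : {ffun 'I_n -> 'I_j.+1} | mindex_deg (mindex a) == j)
       `|wderiv K° (mindex a) w x| `^ q)%R%:E).
      apply/measurable_EFinP; under eq_fun do rewrite big_mkcond.
      apply: measurable_sum => a; case: eqP => [aj|_]; last exact: measurable_cst.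
      exact: mpow.
    rewrite -integral_cst// -ge0_integralZl//; last 2 first.
      by move=> x _; rewrite lee_fin sumr_ge0// => a _; exact: powR_ge0.
      by rewrite lee_fin divr_ge0 ?ltW.
    rewrite -ge0_integralD//; last 3 first.
      by move=> x _; rewrite lee_fin ltW.
      move=> x _; rewrite -EFinM lee_fin mulr_ge0 ?divr_ge0 ?(ltW s0) ?(ltW sq0)//.
      by apply: sumr_ge0 => a _; exact: powR_ge0.
      exact: measurable_funeM.
    apply: ge0_le_integral => //.
    + by apply/measurable_EFinP; apply: measurable_norm; exact: mw.
    + by apply: emeasurable_funD => //; exact: measurable_funeM.
    + move=> x _; rewrite -EFinM -EFinD lee_fin.
      apply: le_trans (le_powR_young s0 (normr_ge0 _) q1) _.
      rewrite lerD2l ler_wpM2l ?divr_ge0 ?(ltW s0) ?(ltW sq0)//.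
      rewrite (bigD1 b) ?bj//= lerDl; apply: sumr_ge0 => a _; exact: powR_ge0.
  apply: (@le_trans _ _ (\sum_(K <- T | P K) (s%:E * leb K°) +
      (s / s `^ q)%:E * \sum_(K <- T | `[< K `<=` G >]) Y K)%E).
    rewrite ge0_sume_distrr; last by move=> K _; exact: Y0.
    apply: (@le_trans _ _ (\sum_(K <- T | (K \in T) && P K)
        (s%:E * leb K° + (s / s `^ q)%:E * Y K))%E).
      by apply: lee_sum => K /andP[KT PK]; exact: hK.
    rewrite big_split/= -big_seq_cond leeD2l//.
    rewrite big_seq_cond [leRHS]big_seq_cond.
    apply: lee_sum_nneg_subset.
      move=> K /and3P[KT _ PK]; apply/andP; split=> //.
      by apply/asboolP; have [] := PQ _ KT PK.
    by move=> K _; rewrite mule_ge0// lee_fin divr_ge0 ?ltW.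
  apply: leeD => //.
  apply: (@le_trans _ _ ((s / s `^ q)%:E * (s `^ q)%:E)%E).
    by rewrite lee_wpmul2l// lee_fin divr_ge0 ?ltW.
  by rewrite -EFinM lee_fin divfK// gt_eqF.
- move=> ws; rewrite -[leLHS]adde0; apply: leeD; last by rewrite lee_fin ltW.
  apply: le_trans sumsQ; rewrite [leRHS]big_seq_cond; apply: lee_sum => K /andP[KT PK].
  have [KG _] := PQ _ KT PK.
  rewrite -integral_cst//; apply: ae_ge0_le_integral => //.
  + by apply/measurable_EFinP; apply: measurable_norm; exact: mw.
  + by move=> x _; rewrite lee_fin ltW.
  have : (Lp_norm K° +oo (wderiv K° (mindex b) w) <= s%:E)%E.
    apply: le_trans (ltW ws); rewrite /pw_norm.
    apply: (@le_trans _ _ (pw_seminorm j +oo G T w)); last first.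
      by apply: (@bigmax_sup_seq _ _ _ _ _ ord_max) => //; rewrite mem_index_enum.
    rewrite /pw_seminorm.
    apply: (@bigmax_sup_seq _ _ _ _ _ K) => //; first exact/asboolP.
    by apply: (@bigmax_sup_seq _ _ _ _ _ b); rewrite ?mem_index_enum ?bj.
  rewrite /Lp_norm unlock lebesgue_rV_setT_gt0 => /ess_supP.
  by apply: filterS => x + Kx; rewrite /= patchE mem_set.
Qed.

End L1_bound.

(** * The lower bound *)

Section lower_bound.
Context {R : realType} {n : nat}.
Implicit Types (G K Q U : set 'rV[R]_n) (T : {fset (set 'rV[R]_n)}) (w g phi psi : 'rV[R]_n -> R).
Local Notation leb := (@lebesgue_rV R n).

Lemma shrunk_itv (l u x y h : R) : l < u ->
  l + (u - l) / 4 <= x <= u - (u - l) / 4 -> `|x - y| <= h -> h < (u - l) / 4 ->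
  l < y < u.
Proof.
by move=> lu /andP[h1 h2]; rewrite ler_norml => /andP[h3 h4] h5; apply/andP; split; lra.
Qed.

Lemma measure_le_cover (r : seq (set 'rV[R]_n)) (P : pred (set 'rV[R]_n)) A
    (F : set 'rV[R]_n -> set 'rV[R]_n) : measurable A -> (forall K, measurable (F K)) ->
  (forall x, A x -> exists K, [/\ K \in r, P K & F K x]) ->
  (leb A <= \sum_(K <- r | P K) leb (F K))%E.
Proof.
move=> mA mF AF.
apply: (@le_trans _ _ (leb (\big[setU/set0]_(K <- r | P K) F K))).
  apply: le_measure; rewrite ?inE//; first exact: bigsetU_measurable.
  move=> x /AF[K [Kr PK FK]]; rewrite -big_filter -bigcup_seq.
  by exists K => //=; rewrite mem_filter PK.
elim: r {AF} => [|K r IH]; first by rewrite !big_nil measure0.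
rewrite !big_cons; case: ifP => // PK.
apply: le_trans (measureU2 _ _ _) _ => //; first exact: bigsetU_measurable.
exact: leeD2l.
Qed.

(** Writing a = g - (g - a) against phi bounds |a| times the integral of phi by the two terms on the
    right. The cube of half side e / 2 has volume e^n, so the integral of phi is at least m e^n. *)
Lemma element_lower_bound U g w phi psi (a m e B : R) c :
  open U -> loc_integrable U g -> measurable_fun U w ->
  test_function U phi -> (forall x, 0 <= phi x <= 1) ->
  0 < e -> cube c (e / 2) `<=` U -> 0 <= m ->
  (forall x, cube c (e / 2) x -> m <= phi x) ->
  smooth psi -> (forall x, `|psi x| <= B) ->
  (`| \int[leb]_(x in U) (g x * phi x)%:E | =
   `| \int[leb]_(x in U) (w x * psi x)%:E |)%E ->
  ((`|a| * (m * e ^+ n))%:E <= \int[leb]_(x in U) `|g x - a|%:E +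
     B%:E * \int[leb]_(x in U) `|w x|%:E)%E.
Proof.
move=> oU lg mw tphi phi01 e0 cU m0 mphi spsi psiB gw.
have mU := open_measurable_rV oU.
have mphi' : measurable_fun U phi.
  by apply: measurable_funTS; apply: continuous_measurable_rV; apply: smooth_continuous; case: tphi.
have mpsi : measurable_fun U psi.
  by apply: measurable_funTS; apply: continuous_measurable_rV; exact: smooth_continuous.
have mga : measurable_fun U (fun x => g x - a).
  by apply: measurable_funB => //; case: lg.
have phi0 x : 0 <= phi x by have /andP[] := phi01 x.
have la : loc_integrable U (cst a) by apply: continuous_loc_integrable => x; exact: cst_continuous.
have iaphi := integrable_test oU la tphi.
have igphi := integrable_test oU lg tphi.
have igaphi := integrable_test oU (loc_integrableB lg la) tphi.
have B0 : 0 <= B by exact: le_trans (normr_ge0 (psi 0)) (psiB 0).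
have lower : ((m * e ^+ n)%:E <= \int[leb]_(x in U) (phi x)%:E)%E.
  apply: (@le_trans _ _ (\int[leb]_(x in cube c (e / 2)) (phi x)%:E)%E); last first.
    apply: ge0_subset_integral => //; first exact: measurable_cube.
      exact/measurable_EFinP.
    by move=> x _; rewrite lee_fin.
  have -> : (m * e ^+ n)%:E = (\int[leb]_(x in cube c (e / 2)) (cst m%:E x))%E.
    rewrite integral_cst; last exact: measurable_cube.
    rewrite -[X in (_ * X)%E]/(leb (cube c (e / 2))) lebesgue_rV_cube; last first.
      by rewrite divr_ge0// ltW.
    rewrite -EFinM.
    by congr (_ * _ ^+ _)%:E; field.
  apply: ge0_le_integral => //.
  - exact: measurable_cube.
  - by apply/measurable_EFinP; apply: measurable_funS mphi'.
have eqa : (\int[leb]_(x in U) (a * phi x)%:E =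
  \int[leb]_(x in U) (g x * phi x)%:E - \int[leb]_(x in U) ((g x - a) * phi x)%:E)%E.
  rewrite -integralB//; apply: eq_integral => x _.
  by rewrite -EFinB mulrBl opprB addrC subrK.
have step1 : ((`|a| * (m * e ^+ n))%:E <= `| \int[leb]_(x in U) (a * phi x)%:E |)%E.
  under eq_integral do rewrite EFinM.
  have -> : (\int[leb]_(x in U) (a%:E * (phi x)%:E) = a%:E * \int[leb]_(x in U) (phi x)%:E)%E.
    rewrite integralZl//.
    have l1 : loc_integrable U (cst 1).
      by apply: continuous_loc_integrable => x; exact: cst_continuous.
    have := integrable_test oU l1 tphi.
    by apply: eq_integrable => // x _; rewrite mul1r.
  rewrite abseM EFinM lee_wpmul2l//.
  by apply: (le_trans lower); exact: lee_abs.
apply: (le_trans step1); rewrite eqa; apply: le_trans (lee_abs_sub _ _) _.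
rewrite gw addeC; apply: leeD.
- apply: le_trans (le_abse_integral _ _ _) _ => //; first by case/integrableP : igaphi.
  apply: ge0_le_integral => //.
  + by apply: measurableT_comp => //; case/integrableP : igaphi.
  + by apply/measurable_EFinP; apply: measurable_norm.
  + move=> x Ux; rewrite /= lee_fin normrM ler_piMr// ger0_norm//.
    by have /andP[] := phi01 x.
- have mwpsi : measurable_fun U (fun x => (w x * psi x)%:E).
    by apply/measurable_EFinP; exact: measurable_funM.
  apply: le_trans (le_abse_integral _ _ _) _ => //.
  rewrite -ge0_integralZl//; last by apply/measurable_EFinP; apply: measurable_norm.
  apply: ge0_le_integral => //.
  + by apply: measurableT_comp.
  + by apply: measurable_funeM; apply/measurable_EFinP; apply: measurable_norm.
  + by move=> x Ux; rewrite /= -EFinM lee_fin normrM mulrC ler_wpM2r.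
Qed.

End lower_bound.

Theorem theorem2p1 (R : realType) (n : nat) (hn : (1 <= n)%N)
    (Omega : set 'rV[R]_n)
    (hOmega : is_domain Omega) (hbounded : bounded_set Omega)
    (hpolytopic : polytopic Omega) (hlipschitz : lipschitz_boundary Omega)
    (I : Type) (T : I -> {fset (set 'rV[R]_n)})
    (hT : forall i, is_mesh Omega (T i))
    (hquasi : quasi_uniform_family T)
    (r : nat) (hr : (1 <= r)%N)
    (V : I -> set ('rV[R]_n -> R))
    (hV : forall i, fe_space r (T i) (V i))
    (G : set 'rV[R]_n) (hG : is_domain G) (hGOmega : G `<=` Omega)
    (p : \bar R) (hp : (1 <= p)%E)
    (delta : R) (hdelta : 0 < delta)
    (u : 'rV[R]_n -> R) (hu : sobolev G (r%:R + delta) p u)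
    (gamma : 'I_n -> nat) (hgamma : mindex_deg gamma = r)
    (hgammau : (0 < Lp_norm G p (wderiv G gamma u))%E)
    (hgammaV : forall i v, V i v -> forall K : set 'rV[R]_n, K \in T i ->
       forall x : 'rV[R]_n, K° x -> mpartial gamma v x = 0) :
  exists2 C1 : R, 0 < C1 &
    exists2 h0 : R, 0 < h0 &
      forall i, mesh_size (T i) < h0 ->
      forall j : nat, (j <= r)%N ->
        ((C1 * mesh_size (T i) ^+ (r - j))%:E <=
         ereal_inf [set pw_norm j p G (T i) (u \- v)%R | v in V i])%E.
Proof.
have [oG _ _] := hG.
pose g := wderiv G gamma u.
(* Weak derivatives of all orders up to r come from the integer part of the regularity. *)
have rtr : (r <= Num.truncn (r%:R + delta))%N.
  by rewrite truncn_ge_nat ?lerDl ?addr_ge0 ?(ltW hdelta).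
have exw a : (mindex_deg a <= r)%N -> exists h, is_weak_deriv G a u h.
  move=> ar; have [hint _] := hu.
  by have [h hw _] := hint a (leq_trans ar rtr); exists h.
have wg : is_weak_deriv G gamma u g.
  by rewrite /g /wderiv; apply: getPex; apply: exw; rewrite hgamma.
have [_ lg _] := wg.
have gn0 : ~ (lebesgue_rV n).-negligible [set x | G x /\ g x != 0].
  by apply: Lp_norm_gt0_nonnegligible hp hgammau => //; case: lg.
have [m m0 [M M0 bump]] := @cube_bump R n r.
have [[sigma s0 hs] [beta b0 hb]] := hquasi.
have nR : 0 < n%:R :> R by rewrite ltr0n.
(* By [element_cube], each element contains a cube of half side kappa h. *)
pose kappa : R := (4 * n%:R * beta * sigma)^-1.
have k0 : 0 < kappa by rewrite invr_gt0 !mulr_gt0.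
(* Makes the deviation eps |a| W equal to X / 2. *)
pose eps : R := m * (kappa / 4) ^+ n / 2.
have eps0 : 0 < eps by rewrite divr_gt0// mulr_gt0// exprn_gt0// divr_gt0.
have [l [u' [a [a0 lu luG conc]]]] := integral_concentration oG lg gn0 eps0.
pose W : R := \prod_i (u' 0 i - l 0 i).
have W0 : 0 < W by apply: prodr_gt0 => i _; rewrite subr_gt0.
have na0 : 0 < `|a| by rewrite normr_gt0.
(* Bounds kappa^-(r - j) for all j at once, so that [C1] does not depend on j. *)
pose L : R := Num.max 1 kappa^-1 ^+ r.
have max1 : 1 <= Num.max 1 kappa^-1 by rewrite le_max lexx.
have L0 : 0 < L by rewrite exprn_gt0// (lt_le_trans ltr01).
(* Solves M L C1 (W + 1) = X / 4; the factor W + 1 stems from the bound s |Q| + s of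
   [seminorm_L1_bound]. *)
pose C1 : R := `|a| * m * (kappa / 4) ^+ n * W / (4 * M * L * (W + 1)).
have kn0 : 0 < (kappa / 4) ^+ n by rewrite exprn_gt0// divr_gt0.
have C10 : 0 < C1 by rewrite /C1 divr_gt0 ?mulr_gt0// ltr_wpDl ?ltW.
exists C1 => //.
(* At most a quarter of each side: an element that meets the middle half of the box then stays
   inside the box. *)
pose h0 : R := \big[Num.min/1]_i ((u' 0 i - l 0 i) / 4).
have h00 : 0 < h0.
  rewrite /h0; elim/big_ind : _ => [|x y x0 y0|k _]; first exact: ltr01.
    by rewrite lt_min x0.
  by rewrite divr_gt0// subr_gt0.
have h0le i : h0 <= (u' 0 i - l 0 i) / 4 by exact: bigmin_le.
exists h0 => // i hi j jr.
apply: le_ereal_inf_tmp => _ [v Vv <-]; rewrite leNgt; apply/negP => ws.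
have [hTpoly hTcov hTdis _] := hT i.
set h := mesh_size (T i) in hi ws *.
pose l' : 'rV[R]_n := \row_k (l 0 k + (u' 0 k - l 0 k) / 4).
pose u'' : 'rV[R]_n := \row_k (u' 0 k - (u' 0 k - l 0 k) / 4).
have lu' k : l' 0 k <= u'' 0 k by rewrite !mxE; have := lu k; lra.
have Q'Q : cbox l' u'' `<=` obox l u'.
  move=> x hx k; have := hx k; rewrite !mxE => {}hx.
  by apply: (shrunk_itv (lu k) hx (h := 0)); rewrite ?subrr ?normr0// divr_gt0// subr_gt0.
have covQ' x : cbox l' u'' x -> exists2 K, K \in T i & K x.
  move=> /Q'Q/obox_sub_cbox/luG/hGOmega/(@subset_closure _ Omega).
  by rewrite hTcov => -[K /= KT Kx]; exists K.
pose P K := `[< exists x, K x /\ cbox l' u'' x >].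
have diam0 K : K \in T i -> 0 < diam K.
  by move=> KT; have [pK K0] := hTpoly K KT; exact: diam_gt0.
(* The maximum defining the mesh size has default 0; a corner of the shrunk box lies in some
   element, whose diameter is positive. *)
have hpos : 0 < h.
  have [K KT _] := covQ' l' (fun k => ltac:(by rewrite lexx lu')).
  exact: lt_le_trans (diam0 K KT) (mesh_size_ge KT).
have coord K x y k : K \in T i -> K x -> K y -> `|x 0 k - y 0 k| <= h.
  move=> KT Kx Ky; have [pK _] := hTpoly K KT.
  have := diam_ge pK Kx Ky; have := coord_le_enorm (x - y) k; rewrite !mxE => h1 h2.
  exact: le_trans h1 (le_trans h2 (mesh_size_ge KT)).
have PQ K : K \in T i -> P K -> K `<=` obox l u'.
  move=> KT /asboolP[x [Kx Qx]] y Ky k; have := coord K x y k KT Kx Ky.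
  have := Qx k; rewrite !mxE => {}Qx xy.
  exact: (shrunk_itv (lu k) Qx xy (lt_le_trans hi (h0le k))).
have PG K : K \in T i -> P K -> K `<=` G.
  by move=> KT PK x /(PQ K KT PK)/obox_sub_cbox/luG.
have oK K : open (K° : set 'rV[R]_n) by exact: open_interior.
have vpoly K : K \in T i -> exists2 q, poly_lt r q & forall x, K° x -> v x = q x.
  by move=> KT; have [_ _ /(_ v Vv K KT)] := hV i.
have KG K : K \in T i -> K `<=` G -> K° `<=` G.
  by move=> _ KG; apply: subset_trans KG; exact: interior_subset.
have jg : (j <= mindex_deg gamma)%N by rewrite hgamma.
have [b bj bE] := mseq_take jg.
have exw' a' : mindex_deg a' = j -> exists h, is_weak_deriv G a' u h.
  by move=> a'j; apply: exw; rewrite a'j.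
have wK K a' : K \in T i -> K `<=` G -> mindex_deg a' = j ->
    is_weak_deriv K° a' (u \- v) (wderiv K° a' (u \- v)).
  move=> KT KG' a'j; apply: (wderiv_element oG (oK K)) => //; first exact: KG.
    exact: vpoly.
  exact: exw'.
pose s : R := C1 * h ^+ (r - j).
have spos : 0 < s by rewrite mulr_gt0// exprn_gt0.
have mQ := measurable_obox l u'.
have L1 := @seminorm_L1_bound R n j p G (T i) (u \- v) s P (obox l u') b hp spos ws bj
  (fun K a' KT KG' a'j => ltac:(by have [_ [mw _] _] := wK K (mindex a') KT KG' a'j))
  hTdis mQ (fun K KT PK => conj (PG K KT PK)
    (subset_trans (@interior_subset _ K) (PQ K KT PK))).
pose e : R := kappa * h.
have e0 : 0 < e by rewrite mulr_gt0.
pose B : R := M * e ^- (r - j).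
have elem K : K \in T i -> P K -> ((`|a| * (m * e ^+ n))%:E <=
    \int[lebesgue_rV n]_(x in K°) `|g x - a|%:E +
    B%:E * \int[lebesgue_rV n]_(x in K°) `|wderiv K° (mindex b) (u \- v) x|%:E)%E.
  move=> KT PK; have [pK K0] := hTpoly K KT.
  have [c] := element_cube pK hn K0 hpos s0 b0 (hs i K KT) (hb i K KT).
  rewrite -/kappa mulrC -/e => cK.
  have [phi [tphi phi01 _ phim phiB]] := bump c e e0.
  have KGo := KG K KT (PG K KT PK).
  have tphiK := tphi _ cK.
  have ce : cube c (e / 2) `<=` cube c e.
    by move=> x hx k; apply: le_trans (hx k) _; rewrite ler_pdivrMr// ler_pMr// ler1n.
  have [sphi _ _] := tphiK.
  apply: (@element_lower_bound R n K° g _ phi (foldr partial phi (drop j (mseq gamma))) a m e B c).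
  - exact: oK.
  - exact: loc_integrable_sub KGo lg.
  - by have [_ [mw _] _] := wK K (mindex b) KT (PG K KT PK) bj.
  - exact: tphiK.
  - exact: phi01.
  - exact: e0.
  - exact: subset_trans cK.
  - exact: ltW.
  - exact: phim.
  - exact: smooth_foldr.
  - move=> x; have := phiB (drop j (mseq gamma)) _ x.
    by rewrite size_drop size_mseq hgamma leq_subr => /(_ isT).
  - apply: (integral_test_element oG (oK K) KGo (vpoly K KT)) => //.
    + by move=> x; exact: (hgammaV i v Vv K KT).
    + exact: exw'.
have mga : measurable_fun (obox l u') (fun x => `|g x - a|%:E).
  apply/measurable_EFinP; apply: measurable_norm; apply: measurable_funB => //.
  have [mg _] := lg; apply: measurable_funS mg; first exact: open_measurable_rV.
  by move=> x /obox_sub_cbox/luG.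
have Gsum : (\sum_(K <- T i | P K) \int[lebesgue_rV n]_(x in K°) `|g x - a|%:E
    <= (eps * `|a| * W)%:E)%E.
  apply: le_trans conc; apply: sum_integral_le => //; first exact: fset_uniq.
  by move=> K KT PK; apply: subset_trans (PQ K KT PK); exact: interior_subset.
have B0 : 0 < B by rewrite mulr_gt0// invr_gt0 exprn_gt0.
have sumelem : (\sum_(K <- T i | P K) (`|a| * (m * e ^+ n))%:E <=
    (eps * `|a| * W)%:E + B%:E * (s * W + s)%:E)%E.
  have leQ : (lebesgue_rV n (obox l u') <= W%:E)%E.
    rewrite /W -lebesgue_rV_cbox; last by move=> k; exact: ltW.
    apply: le_measure; rewrite ?inE//; first exact: measurable_cbox.
    exact: obox_sub_cbox.
  apply: (@le_trans _ _ (\sum_(K <- T i | P K) \int[lebesgue_rV n]_(x in K°) `|g x - a|%:E +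
      B%:E * \sum_(K <- T i | P K)
        \int[lebesgue_rV n]_(x in K°) `|wderiv K° (mindex b) (u \- v) x|%:E)%E).
    rewrite ge0_sume_distrr; last by move=> K _; apply: integral_ge0 => x _; rewrite lee_fin.
    rewrite -big_split/= big_seq_cond [leRHS]big_seq_cond.
    by apply: lee_sum => K /andP[KT PK]; exact: elem.
  apply: leeD => //; rewrite lee_wpmul2l ?lee_fin ?(ltW B0)//.
  apply: (le_trans L1); rewrite EFinD (EFinM s W); apply: leeD2r.
  by apply: lee_wpmul2l => //; rewrite lee_fin ltW.
(* Counts the elements by volume: each one lies in the cube of half side h about any of its points,
   here [get K]. *)
have cover : (lebesgue_rV n (cbox l' u'') <= \sum_(K <- T i | P K) ((2 * h) ^+ n)%:E)%E.
  have := @measure_le_cover R n (T i) P (cbox l' u'') (fun K => cube (get K) h)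
    (measurable_cbox l' u'') (fun K => measurable_cube _ _).
  under eq_bigr do rewrite (lebesgue_rV_cube _ (ltW hpos)).
  apply => x Qx; have [K KT Kx] := covQ' x Qx; exists K; split => //.
    by apply/asboolP; exists x.
  move=> k; apply: (coord K) => //; apply: getPex; by exists x.
(* The factor (kappa / 2)^n turns (2 h)^n into e^n. *)
have : ((`|a| * m * (kappa / 2) ^+ n)%:E * lebesgue_rV n (cbox l' u'') <=
    (eps * `|a| * W)%:E + B%:E * (s * W + s)%:E)%E.
  apply: le_trans sumelem.
  apply: (@le_trans _ _ ((`|a| * m * (kappa / 2) ^+ n)%:E *
      \sum_(K <- T i | P K) ((2 * h) ^+ n)%:E)%E).
    by rewrite lee_wpmul2l// lee_fin !mulr_ge0 ?exprn_ge0 ?divr_ge0// ltW.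
  rewrite ge0_sume_distrr; last by move=> K _; rewrite lee_fin exprn_ge0// mulr_ge0// ltW.
  apply: lee_sum => K _; rewrite -EFinM lee_fin -!mulrA -exprMn.
  by rewrite (_ : kappa / 2 * (2 * h) = e)// /e; field.
rewrite lebesgue_rV_cbox// -!EFinM -EFinD lee_fin.
have -> : \prod_k (u'' 0 k - l' 0 k) = W / 2 ^+ n.
  rewrite /W -[n in 2 ^+ n]card_ord -prodr_const -prodf_div.
  by apply: eq_bigr => k _; rewrite !mxE; field.
pose X := `|a| * m * (kappa / 4) ^+ n * W.
have X0 : 0 < X by rewrite !mulr_gt0.
have -> : `|a| * m * (kappa / 2) ^+ n * (W / 2 ^+ n) = X.
  rewrite /X (_ : kappa / 4 = kappa / 2 / 2); last by field.
  by rewrite [(kappa / 2 / 2) ^+ n]exprMn exprVn; ring.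
have -> : eps * `|a| * W = X / 2 by rewrite /X /eps; field.
(* The powers of h in [B] and [s] cancel, which fixes the rate h^(r - j). *)
have BsE : B * (s * W + s) = M * kappa^-1 ^+ (r - j) * (C1 * (W + 1)).
  rewrite /B /s /e exprMn invfM exprVn; field.
  by rewrite !expf_neq0 ?gt_eqF.
have C1E : M * L * (C1 * (W + 1)) = X / 4.
  by rewrite /C1 -/X; field; rewrite !gt_eqF// addr_gt0.
have kL : kappa^-1 ^+ (r - j) <= L.
  apply: (@le_trans _ _ (Num.max 1 kappa^-1 ^+ (r - j))).
    apply: lerXn2r; [by rewrite nnegrE invr_ge0 ltW| |by rewrite le_max lexx orbT].
    by rewrite nnegrE (le_trans ler01 max1).
  by rewrite /L ler_weXn2l// leq_subr.
have : B * (s * W + s) <= X / 4.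
  have CW : 0 <= C1 * (W + 1) by rewrite mulr_ge0 ?(ltW C10)// addr_ge0// ltW.
  by rewrite BsE -C1E (ler_wpM2r CW)// ler_wpM2l// ltW.
by move: X0; clear; lra.
Qed.
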